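(* There exists a countably infinite family of complete immersed minimal Lagrangian tori in $\mathbb{CP}^2$.
   Context: $\mathbb{CP}^2$ carries the Fubini--Study Kähler metric. Minimal means that the mean curvature vector vanishes identically. *)

(* Defs.v *)
From HB Require Import structures.
From mathcomp Require Import all_boot all_order all_algebra.
From mathcomp Require Import complex.
From mathcomp Require Import all_classical all_reals all_analysis.

Set Implicit Arguments.
Unset Strict Implicit.
Unset Printing Implicit Defensive.

Import Order.TTheory GRing.Theory Num.Theory.
Import numFieldNormedType.Exports.

Local Open Scope classical_set_scope.
Local Open Scope ring_scope.
Local Open Scope complex_scope.

Section Calculus.
Context {R : realType}.

Definition basis_rV m (i : 'I_m) : 'rV[R]_m := delta_mx 0 i.

(* C^k regularity on an open set [A]. *)
Fixpoint Ck_on m n (k : nat) (A : set 'rV[R]_m) (f : 'rV[R]_m -> 'rV[R]_n) :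
    Prop :=
  if k is k'.+1 then
    (forall x, A x -> differentiable f x) /\
    (forall i, Ck_on k' A (fun x => 'D_(basis_rV i) f x))
  else forall x, A x -> {for x, continuous f}.

Definition smooth_on m n (A : set 'rV[R]_m) (f : 'rV[R]_m -> 'rV[R]_n) :=
  forall k, Ck_on k A f.

End Calculus.

(* Extrinsic geometry, in coordinates, of a map [f] from R^m to a domain of R^n
   carrying the Riemannian metric [G] (its Gram matrix in the coordinate
   frame). Row [i] of [jacobian f x] is the partial derivative [d_i f (x)]. *)
Section RiemannianGeometry.
Context {R : realType}.
Variables (m n : nat) (G : 'rV[R]_n -> 'M[R]_n) (f : 'rV[R]_m -> 'rV[R]_n).

Let dG (l i j : 'I_n) (y : 'rV[R]_n) : R :=
  'D_(basis_rV l) (fun z => G z i j) y.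

(* Christoffel symbols [Gamma^c_ab] of the Levi-Civita connection of [G]. *)
Definition christoffel (y : 'rV[R]_n) (c a b : 'I_n) : R :=
  2^-1 * \sum_l invmx (G y) c l * (dG a b l y + dG b a l y - dG l a b y).

Definition first_form (x : 'rV[R]_m) : 'M[R]_m :=
  jacobian f x *m G (f x) *m (jacobian f x)^T.

(* [nabla_(d_i) (d_j f)], the connection being pulled back along [f]. *)
Definition cov_deriv (x : 'rV[R]_m) (i j : 'I_m) : 'rV[R]_n :=
  'D_(basis_rV i) (fun z => 'D_(basis_rV j) f z) x +
  \row_c \sum_a \sum_b
    christoffel (f x) c a b * jacobian f x i a * jacobian f x j b.

(* [G]-orthogonal projection onto the normal space at [x]. *)
Definition normal_part (x : 'rV[R]_m) (v : 'rV[R]_n) : 'rV[R]_n :=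
  v - v *m G (f x) *m (jacobian f x)^T *m invmx (first_form x) *m jacobian f x.

Definition second_form (x : 'rV[R]_m) (i j : 'I_m) : 'rV[R]_n :=
  normal_part x (cov_deriv x i j).

Definition mean_curvature (x : 'rV[R]_m) : 'rV[R]_n :=
  m%:R^-1 *: \sum_i \sum_j invmx (first_form x) i j *: second_form x i j.

End RiemannianGeometry.

Section ProjectivePlane.
Context {R : realType}.
Local Notation C := R[i].

Definition herm n (u v : 'rV[C]_n) : C := \sum_j u 0 j * (v 0 j)^*.

Definition hnorm n (u : 'rV[C]_n) : R := Num.sqrt (complex.Re (herm u u)).

Definition CP2 := {L : {vspace 'rV[C]_3} | \dim L == 1%N}.

(* Homogeneous coordinates; everything below is independent of the choice. *)
Definition homog (L : CP2) : 'rV[C]_3 := vpick (val L).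

Definition chart_dom (k : 'I_3) : set CP2 := [set L | homog L 0 k != 0].

(* The affine chart [z_j / z_k] ([j != k]), with values in R^4: the two real
   parts come first, then the two imaginary parts. *)
Definition chart (k : 'I_3) (L : CP2) : 'rV[R]_4 :=
  let w (j : 'I_2) := homog L 0 (lift k j) / homog L 0 k in
  row_mx (\row_j complex.Re (w j)) (\row_j complex.Im (w j)).

Definition to_complex (w : 'rV[R]_(2 + 2)) : 'rV[C]_2 :=
  \row_j (w 0 (lshift 2 j) +i* w 0 (rshift 2 j)).

(* The Fubini-Study Hermitian metric in an affine chart, normalized to have
   holomorphic sectional curvature 4. *)
Definition fs_herm (w u v : 'rV[C]_2) : C :=
  ((1 + herm w w) * herm u v - herm u w * herm w v) / (1 + herm w w) ^+ 2.

Definition fs_metric (w : 'rV[R]_4) : 'M[R]_4 :=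
  \matrix_(i, j) complex.Re
    (fs_herm (to_complex w) (to_complex (basis_rV i))
                            (to_complex (basis_rV j))).

(* [omega(u, v) = g(J u, v)], with [J] multiplication by [i]. *)
Definition fs_kahler (w : 'rV[R]_4) : 'M[R]_4 :=
  \matrix_(i, j) complex.Re
    (fs_herm (to_complex w) ('i *: to_complex (basis_rV i))
                            (to_complex (basis_rV j))).

(* Geodesic distance of the metric above. *)
Definition fs_dist (L M : CP2) : R :=
  acos (complex.Re `|herm (homog L) (homog M)|
        / (hnorm (homog L) * hnorm (homog M))).

Definition congruent (A B : set CP2) : Prop :=
  exists phi : CP2 -> CP2, [/\ bijective phi,
    forall L M, fs_dist (phi L) (phi M) = fs_dist L M & phi @` A = B].

End ProjectivePlane.

Arguments CP2 : clear implicits.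

(* The torus is R^2 / Z^2: maps out of it are Z^2-periodic maps on R^2. *)
Section Tori.
Context {R : realType}.

Definition lattice_vec (p : 'rV[int]_2) : 'rV[R]_2 := map_mx intr p.

Definition curve_length (g : 'rV[R]_2 -> 'M[R]_2) (c : R -> 'rV[R]_2) :
    \bar R :=
  \int[lebesgue_measure]_(t in `[0%R, 1%R])
    (Num.sqrt ((derive1 c t *m g (c t) *m (derive1 c t)^T) 0 0))%:E.

(* Riemannian distance on R^2 / Z^2 of a Z^2-periodic metric [g]; a curve in
   the torus is given by its lift to R^2. *)
Definition torus_dist (g : 'rV[R]_2 -> 'M[R]_2) (x y : 'rV[R]_2) : \bar R :=
  ereal_inf [set curve_length g c | c in [set c : R -> 'rV[R]_2 |
    [/\ (forall t, derivable c t 1), continuous (derive1 c), c 0 = x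
      & exists p, c 1 = y + lattice_vec p]]].

Definition torus_complete (g : 'rV[R]_2 -> 'M[R]_2) : Prop :=
  forall u : nat -> 'rV[R]_2,
    (forall e : R, 0 < e -> exists N : nat, forall i j : nat,
       (N <= i)%N -> (N <= j)%N -> (torus_dist g (u i) (u j) < e%:E)%E) ->
    exists l, forall e : R, 0 < e -> exists N : nat, forall i : nat,
       (N <= i)%N -> (torus_dist g (u i) l < e%:E)%E.

Variable F : 'rV[R]_2 -> CP2 R.

Definition torus_map : Prop := forall x p, F (x + lattice_vec p) = F x.

(* The conditions below do not depend on the affine chart around [F x]. *)

Definition smooth_map : Prop := forall x, exists k (A : set 'rV[R]_2),
  [/\ open A, A x, A `<=` F @^-1` chart_dom k & smooth_on A (chart k \o F)].

Definition immersion : Prop := smooth_map /\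
  forall x, exists2 k, chart_dom k (F x)
                     & row_free (jacobian (chart k \o F) x).

Definition lagrangian : Prop := forall x, exists2 k, chart_dom k (F x) &
  let J := jacobian (chart k \o F) x in
  J *m fs_kahler (chart k (F x)) *m J^T = 0.

Definition minimal : Prop := forall x, exists2 k, chart_dom k (F x) &
  mean_curvature fs_metric (chart k \o F) x = 0.

Definition induced_metric (g : 'rV[R]_2 -> 'M[R]_2) : Prop :=
  forall x, exists2 k, chart_dom k (F x) &
  g x = first_form fs_metric (chart k \o F) x.

Definition complete : Prop := exists2 g, induced_metric g & torus_complete g.

Definition complete_minimal_lagrangian_torus : Prop :=
  [/\ torus_map, immersion, lagrangian, minimal & complete].

End Tori.

(* Main.v *)
(* The tori are the images in CP^2 of the special Lagrangian cones formed by the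
   points [(u1 e^(i m y), u2 e^(i n y), u3 e^(- i (m + n) y))], where [u] is real
   with [m u1^2 + n u2^2 = (m + n) u3^2] (Mironov, Haskins). In the chart
   [z3 = 1] this quadric becomes an ellipse, so the torus is
   [(A cos s e^(i p t), B sin s e^(i q t))] with [p = 2m + n], [q = m + 2n],
   [A^2 = (m + n) / m], [B^2 = (m + n) / n]: it is doubly periodic without any
   period condition, and its first fundamental form is diagonal. We take
   [m = N + 1] and [n = N].

   The ranges are told apart by their circumradius in CP^2, that is, by
   [sup_P inf_L |<P, L>|^2] for unit [P] in C^3 and unit [L] over the torus. The
   supremum is attained at [P = (0, 0, 1)] and equals [n / (m + 2n)], which is
   [N / (3N + 1)]. *)
Require Import Defs.
From mathcomp Require Import all_boot all_order all_algebra.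
From mathcomp Require Import complex.
From mathcomp Require Import ring lra.
From mathcomp Require Import all_classical all_reals all_analysis.
From mathcomp Require Import measurable_realfun.

Set Implicit Arguments.
Unset Strict Implicit.
Unset Printing Implicit Defensive.

Import Order.TTheory GRing.Theory Num.Theory.
Import numFieldNormedType.Exports.

Local Open Scope classical_set_scope.
Local Open Scope ring_scope.
Local Open Scope complex_scope.

(** * The Fubini-Study metric in an affine chart *)

Section FubiniStudy.
Context {R : realType}.
Implicit Types (u v w : 'rV[R]_4).

(** With [m] and [n] positive, the third coordinate never vanishes on the cone, so one affine chart
    carries the whole torus and every local condition becomes an identity between explicit
    trigonometric maps. The choice of consecutive [m] and [n] gives p - q = 1, which simplifies both
    the metric coefficients and the relative phases in the overlap estimate.

    [congruent] admits every distance-preserving bijection of CP^2, with no assumption that it comes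
    from a unitary or antiunitary map. The invariant must therefore be purely metric. The distance
    determines the squared cosine [overlap], and the circumradius is expressed through overlaps
    alone. Since such a bijection may send the centre (0, 0, 1) to any point, the upper bound has to
    be proved for all [P]; together with the lower bound at the centre, it makes the classification
    of isometries unnecessary. *)

Definition dot n (u v : 'rV[R]_n) : R := (u *m v^T) 0 0.

Lemma dotE n (u v : 'rV[R]_n) : dot u v = \sum_j u 0 j * v 0 j.
Proof. by rewrite /dot mxE; apply: eq_bigr => j _; rewrite mxE. Qed.

Lemma dotC n (u v : 'rV[R]_n) : dot u v = dot v u.
Proof. by rewrite !dotE; apply: eq_bigr => j _; rewrite mulrC. Qed.

Lemma dot_ge0 n (u : 'rV[R]_n) : 0 <= dot u u.
Proof. by rewrite dotE; apply: sumr_ge0 => j _; exact: sqr_ge0. Qed.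

Lemma dot_basisl n (i : 'I_n) (u : 'rV[R]_n) : dot (basis_rV i) u = u 0 i.
Proof. by rewrite /dot -rowE !mxE. Qed.

Lemma dot_basisr n (i : 'I_n) (u : 'rV[R]_n) : dot u (basis_rV i) = u 0 i.
Proof. by rewrite dotC dot_basisl. Qed.

(* Right multiplication by [Jmx] is multiplication by [i] on C^2 = R^4. *)
Definition Jmx : 'M[R]_4 := @block_mx R 2 2 2 2 0 1%:M (- 1%:M) 0.

Lemma mul_Jmx (x y : 'rV[R]_2) :
  (row_mx x y : 'rV[R]_4) *m Jmx = row_mx (- y) x.
Proof.
rewrite /Jmx (@mul_row_block R 1 2 2 2 2).
by rewrite !mulmx0 !mulmxN !mulmx1 add0r addr0.
Qed.

Lemma tr_Jmx : Jmx^T = - Jmx.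
Proof.
rewrite /Jmx (@tr_block_mx R 2 2 2 2) !trmx0 linearN /= trmx1.
by rewrite (@opp_block_mx R 2 2 2 2) !oppr0 opprK.
Qed.

Lemma Jmx2 : Jmx *m Jmx = - 1%:M.
Proof.
rewrite /Jmx (@mulmx_block R 2 2 2 2 2 2) !mulmx0 !mul0mx !mul1mx !mulmx1.
rewrite !add0r !addr0.
by rewrite [in RHS](@scalar_mx_block R 2 2 1) (@opp_block_mx R 2 2 2 2) oppr0.
Qed.

Lemma dotJl u v : dot (u *m Jmx) v = - dot u (v *m Jmx).
Proof.
by rewrite /dot trmx_mul tr_Jmx mulNmx mulmxN -mulmxA [in RHS]mxE opprK.
Qed.

Lemma dotJ u : dot (u *m Jmx) u = 0.
Proof. by have := dotJl u u; rewrite [in RHS]dotC; lra. Qed.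

Lemma dotJJ u v : dot (u *m Jmx) (v *m Jmx) = dot u v.
Proof.
by rewrite dotJl -mulmxA Jmx2 mulmxN mulmx1 /dot linearN mulmxN !mxE opprK.
Qed.

Lemma sub_to_complex u j :
  to_complex u 0 j = u 0 (lshift 2 j) +i* u 0 (rshift 2 j).
Proof. by rewrite mxE. Qed.

Lemma herm_to_complex u v :
  herm (to_complex u) (to_complex v) = dot u v +i* dot u (v *m Jmx).
Proof.
rewrite -[u](@hsubmxK R 1 2 2) -[v](@hsubmxK R 1 2 2) mul_Jmx /herm.
rewrite !dotE !(@big_split_ord _ _ _ 2 2) /= !big_ord_recl !big_ord0 /=.
rewrite !sub_to_complex !(@row_mxEl R 1 2 2) !(@row_mxEr R 1 2 2) !mxE.
by apply/eqP; rewrite eq_complex /=; apply/andP; split; apply/eqP; ring.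
Qed.

Lemma to_complexJ u : 'i *: to_complex u = to_complex (u *m Jmx).
Proof.
rewrite -[u](@hsubmxK R 1 2 2) mul_Jmx; apply/rowP => j.
rewrite mxE !sub_to_complex !(@row_mxEl R 1 2 2) !(@row_mxEr R 1 2 2) !mxE.
by apply/eqP; rewrite eq_complex /=; apply/andP; split; apply/eqP; ring.
Qed.

Definition rho w : R := 1 + dot w w.

Lemma rho_gt0 w : 0 < rho w.
Proof. by rewrite /rho ltr_wpDr ?dot_ge0. Qed.

Lemma rho_neq0 w : rho w != 0.
Proof. by rewrite gt_eqF ?rho_gt0. Qed.

(** The complex line of [w] is the real plane spanned by [w] and [w *m Jmx], so the rank-one
    Hermitian correction turns into two real rank-one terms. *)
Lemma Re_fs_herm w u v :
  complex.Re (fs_herm (to_complex w) (to_complex u) (to_complex v)) =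
  (rho w)^-1 * dot u v - (rho w)^-1 ^+ 2 *
    (dot u w * dot w v + dot u (w *m Jmx) * dot (w *m Jmx) v).
Proof.
rewrite /fs_herm !herm_to_complex dotC dotJ dotJl.
have -> : 1 + (dot w w)%:C = (rho w)%:C by rewrite /rho rmorphD rmorph1.
rewrite -rmorphXn -fmorphV.
have -> (z : R[i]) (r : R) : complex.Re (z * r%:C) = complex.Re z * r.
  by case: z => a b /=; ring.
by have := rho_neq0 w => ?; rewrite /=; field.
Qed.

(** This is [dot w w] times the orthogonal projection onto the complex line of [w]; left
    unnormalized, it also covers [w = 0]. *)
Definition proj_mx w : 'M[R]_4 :=
  w^T *m w + (w *m Jmx)^T *m (w *m Jmx).

Lemma proj_mxE w i j :
  proj_mx w i j = w 0 i * w 0 j + (w *m Jmx) 0 i * (w *m Jmx) 0 j.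
Proof. by rewrite !mxE !big_ord1 !mxE. Qed.

Lemma fs_metricE w :
  fs_metric w = (rho w)^-1 *: 1%:M - (rho w)^-1 ^+ 2 *: proj_mx w.
Proof.
apply/matrixP => i j; rewrite mxE Re_fs_herm !dot_basisl !dot_basisr.
rewrite [in RHS]mxE [X in _ = X + _]mxE [X in _ = _ + X]mxE [X in _ = _ - X]mxE.
by rewrite proj_mxE [(1%:M : 'M[R]_4) _ _]mxE mxE eqxx eq_sym.
Qed.

Lemma mul_outer n (a b u v : 'rV[R]_n) :
  u *m (a^T *m b) *m v^T = (dot u a * dot b v)%:M.
Proof.
rewrite mulmxA -mulmxA [u *m _]mx11_scalar [b *m _]mx11_scalar.
by rewrite -scalar_mxM.
Qed.

Lemma fs_metric_dot w u v : (u *m fs_metric w *m v^T) 0 0 =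
  (rho w)^-1 * dot u v - (rho w)^-1 ^+ 2 *
    (dot u w * dot w v + dot u (w *m Jmx) * dot (w *m Jmx) v).
Proof.
rewrite fs_metricE mulmxBr mulmxBl -!scalemxAr -!scalemxAl mulmx1.
rewrite /proj_mx mulmxDr mulmxDl !mul_outer [u *m v^T]mx11_scalar.
by rewrite -raddfD !scale_scalar_mx -raddfB mxE eqxx mulr1n.
Qed.

Lemma fs_kahlerE w : fs_kahler w = Jmx *m fs_metric w.
Proof.
apply/matrixP => i j; rewrite mxE to_complexJ Re_fs_herm -fs_metric_dot.
by rewrite -(mulmxA (basis_rV i)) /basis_rV trmx_delta -colE -rowE mxE mxE.
Qed.

(** As [proj_mx w] squares to [dot w w] times itself, the inverse can be sought as a combination of
    the identity and [proj_mx w]. *)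
Lemma fs_metric_inv w :
  fs_metric w *m (rho w *: (1%:M + proj_mx w)) = 1%:M.
Proof.
have PP : proj_mx w *m proj_mx w = dot w w *: proj_mx w.
  apply/matrixP => i j; rewrite mxE [RHS]mxE.
  under eq_bigr do rewrite !proj_mxE.
  transitivity (w 0 i * w 0 j * dot w w +
    (w 0 i * (w *m Jmx) 0 j + (w *m Jmx) 0 i * w 0 j) * dot (w *m Jmx) w +
    (w *m Jmx) 0 i * (w *m Jmx) 0 j * dot (w *m Jmx) (w *m Jmx)).
    rewrite !dotE !mulr_sumr -!big_split /=; apply: eq_bigr => k _; ring.
  by rewrite dotJ dotJJ proj_mxE; ring.
rewrite fs_metricE -scalemxAr mulmxDr mulmx1 mulmxBl -!scalemxAl mul1mx PP.
apply/matrixP => i j; rewrite !mxE.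
by have := rho_neq0 w; rewrite /rho => ?; field.
Qed.

Lemma invmx_fs_metric w :
  invmx (fs_metric w) = rho w *: (1%:M + proj_mx w).
Proof.
have [U _] := mulmx1_unit (fs_metric_inv w).
by rewrite -[RHS](mulKmx U) fs_metric_inv mulmx1.
Qed.

Lemma is_derive_mulmx n k (M : 'M[R]_(n, k)) (i : 'I_k) (z v : 'rV[R]_n) :
  is_derive z v (fun y : 'rV[R]_n => (y *m M) 0 i) ((v *m M) 0 i).
Proof.
have H : (fun h : R => h^-1 *: (((h *: v + z) *m M) 0 i - (z *m M) 0 i)) @ 0^'
    --> (v *m M) 0 i.
  apply: cvg_near_cst; near=> h.
  rewrite mulmxDl -scalemxAl !mxE addrK /GRing.scale /= mulrA mulVf ?mul1r //.
  by near: h; exact: nbhs_dnbhs_neq.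
by split; [apply/cvg_ex; exists ((v *m M) 0 i) | exact/cvg_lim].
Unshelve. all: by end_near. Qed.

Lemma is_derive_coord n (i : 'I_n) (z v : 'rV[R]_n) :
  is_derive z v (fun y : 'rV[R]_n => y 0 i) (v 0 i).
Proof.
have := is_derive_mulmx 1%:M i z v; rewrite mulmx1.
rewrite (_ : (fun y => (y *m _) 0 i) = fun y => y 0 i) //.
by apply/funext => y; rewrite mulmx1.
Qed.

Lemma is_derive_rho z v : is_derive z v rho (2 * dot v z).
Proof.
have -> : rho = cst 1 + \sum_j (fun y : 'rV[R]_4 => y 0 j * y 0 j).
  apply/funext => y; rewrite /rho dotE /= fctE; congr (_ + _).
  by rewrite fct_sumE.
have H j := @is_derive_coord _ j z v.
apply: is_derive_eq; rewrite add0r dotE mulr_sumr; apply: eq_bigr => j _.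
by rewrite /GRing.scale /=; ring.
Qed.

Lemma row_linE n (i : 'I_n) :
  (forall u v : 'rV[R]_n, (u + v) 0 i = u 0 i + v 0 i)
  * (forall u : 'rV[R]_n, (- u) 0 i = - u 0 i)
  * (forall (a : R) (u : 'rV[R]_n), (a *: u) 0 i = a * u 0 i).
Proof. by do !split; move=> *; rewrite mxE. Qed.

Lemma dot_linE n (w : 'rV[R]_n) :
  (forall u v : 'rV[R]_n, dot w (u + v) = dot w u + dot w v) *
  (forall u : 'rV[R]_n, dot w (- u) = - dot w u) *
  (forall a (u : 'rV[R]_n), dot w (a *: u) = a * dot w u).
Proof.
split; first split; move=> *; rewrite /dot.
- by rewrite linearD mulmxDr mxE.
- by rewrite linearN mulmxN mxE.
- by rewrite linearZ -scalemxAr mxE.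
Qed.

Lemma coord_sum_delta n (u : 'rV[R]_n) c : u 0 c = \sum_a u 0 a * (a == c)%:R.
Proof.
rewrite (bigD1 c) //= eqxx mulr1 big1 ?addr0 // => k /negPf ->.
by rewrite mulr0.
Qed.

Lemma Jmx_antisym (i j : 'I_4) : Jmx i j = - Jmx j i.
Proof. by have /matrixP/(_ j i) := tr_Jmx; rewrite !mxE => ->. Qed.

Lemma basis_rVE n (i j : 'I_n) : (basis_rV i : 'rV[R]_n) 0 j = (i == j)%:R.
Proof. by rewrite mxE eqxx eq_sym. Qed.

Lemma basis_rV_mul n k (M : 'M[R]_(n, k)) (i : 'I_n) (j : 'I_k) :
  (basis_rV i *m M) 0 j = M i j.
Proof. by rewrite -rowE mxE. Qed.

Lemma derive_fs_metric (l i j : 'I_4) z :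
  'D_(basis_rV l) (fun y => fs_metric y i j) z =
  - (2 * z 0 l * (rho z)^-1 ^+ 2 * (i == j)%:R)
  + 4 * z 0 l * (rho z)^-1 ^+ 3 * proj_mx z i j
  - (rho z)^-1 ^+ 2 *
    ((l == i)%:R * z 0 j + z 0 i * (l == j)%:R +
     Jmx l i * (z *m Jmx) 0 j + (z *m Jmx) 0 i * Jmx l j).
Proof.
have -> : (fun y => fs_metric y i j) =
    (fun y => (rho y)^-1) * cst ((i == j)%:R : R) -
    (fun y => (rho y)^-1) ^+ 2 *
    ((fun y : 'rV[R]_4 => y 0 i) * (fun y : 'rV[R]_4 => y 0 j) +
     (fun y => (y *m Jmx) 0 i) * (fun y => (y *m Jmx) 0 j)).
  apply/funext => y; rewrite !fctE -proj_mxE.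
  by rewrite fs_metricE [proj_mx y]lock !mxE -lock.
have Hr := is_derive_rho z (basis_rV l).
have Hc k := @is_derive_coord _ k z (basis_rV l).
have HJ k := @is_derive_mulmx _ _ Jmx k z (basis_rV l).
have HV : is_derive z (basis_rV l) (fun y => (rho y)^-1)
    (- (rho z) ^- 2 *: (2 * dot (basis_rV l) z)).
  have [Hd <-] := Hr.
  by split; [exact: derivableV (rho_neq0 z) _ | rewrite deriveV ?rho_neq0].
rewrite [LHS]derive_val !fctE dot_basisl !basis_rVE !basis_rV_mul.
rewrite proj_mxE /GRing.scale /=.
by have := rho_neq0 z => ?; field.
Qed.

Lemma christoffel_fs (w : 'rV[R]_4) (c a b : 'I_4) :
  christoffel fs_metric w c a b = - (rho w)^-1 *
    (w 0 a * (b == c)%:R + w 0 b * (a == c)%:R +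
     (w *m Jmx) 0 b * Jmx a c + (w *m Jmx) 0 a * Jmx b c).
Proof.
set r := (rho w)^-1; set z := w *m Jmx.
pose e (i : 'I_4) : 'rV[R]_4 := basis_rV i.
(* [T] collects the Christoffel symbols of the first kind. When the index is raised, the components
   of its first line along [w] and [z] cancel the cubic terms in [r], and only terms linear in [w]
   and [z] survive. *)
pose T := - r ^+ 2 *: (w 0 a *: e b + w 0 b *: e a +
                       z 0 b *: (e a *m Jmx) + z 0 a *: (e b *m Jmx)) +
  (2 * r ^+ 3) *: ((w 0 a * w 0 b - z 0 a * z 0 b) *: w +
                   (w 0 a * z 0 b + w 0 b * z 0 a) *: z).
have TE l : 'D_(basis_rV a) (fun y => fs_metric y b l) w +
    'D_(basis_rV b) (fun y => fs_metric y a l) w -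
    'D_(basis_rV l) (fun y => fs_metric y a b) w = 2 * T 0 l.
  rewrite !derive_fs_metric -/z -/r !proj_mxE -/z.
  (* Each entry of [Jmx] and each Kronecker symbol is given one orientation, so that [ring] sees
     equal atoms. *)
  rewrite (Jmx_antisym b a) (Jmx_antisym l a) (Jmx_antisym l b).
  rewrite /T !row_linE !basis_rVE !basis_rV_mul.
  rewrite (eq_sym b a) (eq_sym l a) (eq_sym l b).
  ring.
have -> : christoffel fs_metric w c a b =
    rho w * (T 0 c + w 0 c * dot w T + z 0 c * dot z T).
  rewrite /christoffel invmx_fs_metric.
  under eq_bigr => l _ do rewrite TE.
  rewrite -(dot_basisl c T) !dotE !mulr_sumr -!big_split /= mulr_sumr.
  apply: eq_bigr => l _.
  have -> : (rho w *: (1%:M + proj_mx w)) c l =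
      rho w * ((c == l)%:R + proj_mx w c l).
    by rewrite [proj_mx w]lock !mxE.
  by rewrite proj_mxE basis_rVE -/z; field.
have wJ i : dot w (e i *m Jmx) = - z 0 i by rewrite -dot_basisr dotJl opprK.
have zJ i : dot z (e i *m Jmx) = w 0 i by rewrite dotJJ dot_basisr.
have zw : dot z w = 0 by exact: dotJ.
have wz : dot w z = 0 by rewrite dotC.
have zz : dot z z = dot w w by exact: dotJJ.
rewrite /T !row_linE !dot_linE !wJ !zJ !dot_basisr zw wz zz !basis_rVE.
rewrite !basis_rV_mul /r.
by have := rho_neq0 w; rewrite /rho => ?; field.
Qed.

(* In complex notation, [- (<u, w> v + <v, w> u) / (1 + |w|^2)]. *)
Lemma christoffel_fs_sum m (w : 'rV[R]_4) (U : 'M[R]_(m, 4)) (i j : 'I_m) :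
  let u := row i U in let v := row j U in
  \row_c \sum_a \sum_b christoffel fs_metric w c a b * U i a * U j b =
  - (rho w)^-1 *: (dot w u *: v + dot w v *: u +
    dot (w *m Jmx) v *: (u *m Jmx) + dot (w *m Jmx) u *: (v *m Jmx)).
Proof.
move=> u v; apply/rowP => c; rewrite mxE !row_linE.
set z := w *m Jmx.
rewrite (coord_sum_delta u c) (coord_sum_delta v c).
rewrite !dotE [(u *m Jmx) _ _]mxE [(v *m Jmx) _ _]mxE.
rewrite [X in X + _ + _ + _]mulr_suml [X in _ + X + _ + _]mulr_sumr.
rewrite [X in _ + _ + X + _]mulr_sumr [X in _ + _ + _ + X]mulr_suml.
rewrite -!big_split /= mulr_sumr; apply: eq_bigr => a _.
rewrite !mulr_sumr !mulr_suml -!big_split /= mulr_sumr.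
apply: eq_bigr => b _; rewrite christoffel_fs -/z !mxE; ring.
Qed.
End FubiniStudy.

(** * Products of sines and their derivatives *)

Section TrigonometricMaps.
Context {R : realType}.

Lemma is_derive_comp1 (V : normedModType R) (f : R -> R) (g : V -> R)
    (x v : V) (df : R) :
  differentiable g x -> is_derive (g x) 1 f df ->
  differentiable (f \o g) x /\ is_derive x v (f \o g) (df * 'D_v g x).
Proof.
move=> dg [df1 dfE].
have dfg : differentiable f (g x) by apply/derivable1_diffP.
have dc : differentiable (f \o g) x by exact: differentiable_comp.
split; first exact: dc.
split; first exact: diff_derivable.
rewrite deriveE // diff_comp // /= deriveE // deriv1E //= derive1E dfE.
by rewrite mulrC.
Qed.

(** A family closed under partial derivatives: differentiation multiplies the coefficient by a
    frequency and advances a phase by [pi / 2]. Cosines are sines of shifted phase. *)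
Definition trig n (C a p b q : 'I_n -> R) (x : 'rV[R]_2) : 'rV[R]_n :=
  \row_c (C c * sin (a c * x 0 0 + p c) * sin (b c * x 0 1 + q c)).

Lemma differentiable_affine_coord (a p : R) (i : 'I_2) (x : 'rV[R]_2) :
  differentiable (fun y : 'rV[R]_2 => a * y 0 i + p) x.
Proof.
apply: differentiableD; last exact: differentiable_cst.
by apply: differentiableM => //; exact: differentiable_coord.
Qed.

Lemma derive_affine_coord (a p : R) (i : 'I_2) (x v : 'rV[R]_2) :
  'D_v (fun y : 'rV[R]_2 => a * y 0 i + p) x = a * v 0 i.
Proof.
have H := @is_derive_coord R _ i x v.
have -> : (fun y : 'rV[R]_2 => a * y 0 i + p) =
   cst a * (fun y : 'rV[R]_2 => y 0 i) + cst p by apply/funext.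
by rewrite derive_val /GRing.scale /= mulr0 !addr0.
Qed.

Lemma is_derive_sin_affine (a p : R) (i : 'I_2) (x v : 'rV[R]_2) :
  let f (y : 'rV[R]_2) := sin (a * y 0 i + p) in
  differentiable f x /\
  is_derive x v f (sin (a * x 0 i + (p + pi / 2)) * (a * v 0 i)).
Proof.
have := @is_derive_comp1 _ sin _ x v _ (differentiable_affine_coord a p i x)
  (is_derive_sin _).
by rewrite derive_affine_coord -sinDpihalf addrA.
Qed.

Lemma trig_comp_is_derive (C a p b q : R) (x v : 'rV[R]_2) :
  let f (y : 'rV[R]_2) := C * sin (a * y 0 0 + p) * sin (b * y 0 1 + q) in
  differentiable f x /\
  is_derive x v f
   (C * a * v 0 0 * sin (a * x 0 0 + (p + pi / 2)) * sin (b * x 0 1 + q) +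
    C * b * v 0 1 * sin (a * x 0 0 + p) * sin (b * x 0 1 + (q + pi / 2))).
Proof.
move=> f.
have [d1 D1] := is_derive_sin_affine a p 0 x v.
have [d2 D2] := is_derive_sin_affine b q 1 x v.
have -> : f = cst C * (fun y : 'rV[R]_2 => sin (a * y 0 0 + p)) *
    (fun y : 'rV[R]_2 => sin (b * y 0 1 + q)) by apply/funext.
split; first by do !apply: differentiableM.
by apply: is_derive_eq; rewrite !fctE /GRing.scale /=; ring.
Qed.

Lemma differentiable_row n (f : 'rV[R]_2 -> 'rV[R]_n) x :
  (forall c, differentiable (fun y => f y 0 c) x) -> differentiable f x.
Proof.
move=> df.
have -> : f = \sum_c (fun y => f y 0 c *: (delta_mx 0 c : 'rV[R]_n)).
  by apply/funext => y; rewrite fct_sumE; exact: row_sum_delta.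
by apply: differentiable_sum => c; exact: differentiableZl.
Qed.

Lemma differentiable_trig n (C a p b q : 'I_n -> R) x :
  differentiable (trig C a p b q) x.
Proof.
apply: differentiable_row => c.
have [d _] := trig_comp_is_derive (C c) (a c) (p c) (b c) (q c) x 0.
by under eq_fun do rewrite mxE.
Qed.

Lemma derive_trig n (C a p b q : 'I_n -> R) (i : 'I_2) :
  (fun x => 'D_(basis_rV i) (trig C a p b q) x) =
  if i == 0 then trig (fun c => C c * a c) a (fun c => p c + pi / 2) b q
  else trig (fun c => C c * b c) a p b (fun c => q c + pi / 2).
Proof.
apply/funext => x.
rewrite derive_mx; last exact/diff_derivable/differentiable_trig.
apply/rowP => c; rewrite mxE.
have [_ D] := trig_comp_is_derive (C c) (a c) (p c) (b c) (q c) x (basis_rV i).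
under eq_fun do rewrite mxE.
rewrite derive_val !basis_rVE.
by case: i {D} => [[|[|//]] ?]; rewrite mxE /=
  ?(mulr1, mulr0, mul0r, addr0, add0r).
Qed.

Lemma derive_trigE n (C a p b q : 'I_n -> R) (i : 'I_2) x :
  'D_(basis_rV i) (trig C a p b q) x =
  (if i == 0 then trig (fun c => C c * a c) a (fun c => p c + pi / 2) b q
  else trig (fun c => C c * b c) a p b (fun c => q c + pi / 2)) x.
Proof. by rewrite -derive_trig. Qed.

Lemma smooth_trig n (C a p b q : 'I_n -> R) (A : set 'rV[R]_2) :
  smooth_on A (trig C a p b q).
Proof.
(* Amplitudes and phases change under differentiation and are generalized; the frequencies stay
   fixed. *)
move=> k; elim: k C p q => [|k IH] C p q /=.
  by move=> x _; exact/differentiable_continuous/differentiable_trig.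
split=> [x _|i]; first exact: differentiable_trig.
by rewrite derive_trig; case: ifP => _; exact: IH.
Qed.

Lemma row_jacobian m n (f : 'rV[R]_m -> 'rV[R]_n) x i :
  differentiable f x -> row i (jacobian f x) = 'D_(basis_rV i) f x.
Proof. by move=> df; rewrite deriveEjacobian // -rowE. Qed.
End TrigonometricMaps.

Lemma sum_ord2 (V : nmodType) (f : 'I_2 -> V) : \sum_i f i = f 0 + f 1.
Proof.
rewrite big_ord_recl big_ord1; congr (_ + f _); exact/val_inj.
Qed.

(** * Surfaces with diagonal first fundamental form *)

Section DiagonalFirstForm.
Context {R : realType}.
Variables (n : nat) (G : 'rV[R]_n -> 'M[R]_n) (f : 'rV[R]_2 -> 'rV[R]_n).
Variables (x : 'rV[R]_2) (d : 'rV[R]_2).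
Hypothesis ffE : first_form G f x = diag_mx d.
Hypothesis d_neq0 : forall i, d 0 i != 0.

Lemma first_form_inv : first_form G f x *m diag_mx (\row_i (d 0 i)^-1) = 1%:M.
Proof.
rewrite ffE; apply/matrixP => i j.
by rewrite mul_diag_mx !mxE mulrnAr divff.
Qed.

Lemma first_form_unit : first_form G f x \in unitmx.
Proof. by have [] := mulmx1_unit first_form_inv. Qed.

Lemma invmx_first_form :
  invmx (first_form G f x) = diag_mx (\row_i (d 0 i)^-1).
Proof.
by rewrite -[RHS](mulKmx first_form_unit) first_form_inv mulmx1.
Qed.

(** Since J G J^T is invertible, G J^T (J G J^T)^-1 is a right inverse of J. *)
Lemma row_free_jacobian : row_free (jacobian f x).
Proof.
apply/row_freeP.
exists (G (f x) *m (jacobian f x)^T *m invmx (first_form G f x)).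
by rewrite !mulmxA mulmxV // first_form_unit.
Qed.

Lemma normal_part_tangent (u : 'rV[R]_2) :
  normal_part G f x (u *m jacobian f x) = 0.
Proof.
rewrite /normal_part.
have -> : u *m jacobian f x *m G (f x) *m (jacobian f x)^T =
    u *m first_form G f x by rewrite /first_form !mulmxA.
by rewrite mulmxK ?first_form_unit // subrr.
Qed.

Lemma normal_partDZ (a b : R) (u v : 'rV[R]_n) :
  normal_part G f x (a *: u + b *: v) =
  a *: normal_part G f x u + b *: normal_part G f x v.
Proof.
rewrite /normal_part !mulmxDl -!scalemxAl !scalerBr.
by rewrite opprD addrACA.
Qed.

(** The diagonal inverse leaves only two terms in the trace, and [normal_part] is linear and kills
    tangent vectors. It thus suffices that the weighted trace of [cov_deriv] be tangent, with
    components [u]. *)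
Lemma mean_curvature_eq0 (u : 'rV[R]_2) :
  (d 0 0)^-1 *: cov_deriv G f x 0 0 + (d 0 1)^-1 *: cov_deriv G f x 1 1 =
    u *m jacobian f x ->
  mean_curvature G f x = 0.
Proof.
move=> H; rewrite /mean_curvature.
have diagE i : \sum_j invmx (first_form G f x) i j *: second_form G f x i j =
    (d 0 i)^-1 *: second_form G f x i i.
  rewrite invmx_first_form (bigD1 i) //= big1 => [|j /negPf ji].
    by rewrite addr0 !mxE eqxx.
  by rewrite !mxE eq_sym ji scale0r.
under eq_bigr do rewrite diagE.
rewrite sum_ord2 /second_form -normal_partDZ H.
by rewrite normal_part_tangent scaler0.
Qed.
End DiagonalFirstForm.

(** * The torus in the affine chart and its partial derivatives *)

Section TorusInChart.
Context {R : realType}.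

Lemma mulmx_rows m n (A : 'M[R]_(m, n)) (M : 'M[R]_n) i j :
  (A *m M *m A^T) i j = (row i A *m M *m (row j A)^T) 0 0.
Proof.
by rewrite -row_mul mxE [RHS]mxE; apply: eq_bigr => k _; rewrite !mxE.
Qed.

Definition vec4 (a b c d : R) : 'rV[R]_4 := \row_i nth 0 [:: a; b; c; d] i.

Lemma dot_vec4 a b c d a' b' c' d' :
  dot (vec4 a b c d) (vec4 a' b' c' d') = a * a' + b * b' + c * c' + d * d'.
Proof. by rewrite dotE !big_ord_recl big_ord0 !mxE /=; ring. Qed.

Lemma vec4P (u v : 'rV[R]_4) :
  u 0 0 = v 0 0 -> u 0 1 = v 0 1 -> u 0 2%:R = v 0 2%:R ->
  u 0 3%:R = v 0 3%:R -> u = v.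
Proof.
move=> h0 h1 h2 h3; apply/rowP => -[[|[|[|[|//]]]] i4].
- by rewrite (_ : Ordinal i4 = 0) //; exact/val_inj.
- by rewrite (_ : Ordinal i4 = 1) //; exact/val_inj.
- by rewrite (_ : Ordinal i4 = 2%:R) //; exact/val_inj.
- by rewrite (_ : Ordinal i4 = 3%:R) //; exact/val_inj.
Qed.

Lemma vec4_row_mx (a b c d : R) :
  vec4 a b c d = row_mx (\row_(i < 2) nth 0 [:: a; b] i)
                        (\row_(i < 2) nth 0 [:: c; d] i).
Proof.
apply/rowP => i; case: (split_ordP (i : 'I_(2 + 2))) => j ->.
  by rewrite (@row_mxEl R 1 2 2) !mxE; case: j => [[|[|//]] ?].
by rewrite (@row_mxEr R 1 2 2) !mxE; case: j => [[|[|//]] ?].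
Qed.

Lemma vec4J a b c d : vec4 a b c d *m Jmx = vec4 (- c) (- d) a b.
Proof.
rewrite !vec4_row_mx mul_Jmx; congr (@row_mx R 1 2 2 _ _); apply/rowP => i.
by rewrite !mxE; case: i => [[|[|//]] ?].
Qed.

Variables (A B p q : R).
Notation tau := (@pi R *+ 2).
Implicit Type x : 'rV[R]_2.

Definition torus_chart x : 'rV[R]_4 :=
  let s := tau * x 0 0 in let t := tau * x 0 1 in
  vec4 (A * cos s * cos (p * t)) (B * sin s * cos (q * t))
       (A * cos s * sin (p * t)) (B * sin s * sin (q * t)).

Lemma torus_chart_trig : torus_chart = trig
  (nth 0 [:: A; B; A; B] \o val) (fun=> tau)
  (nth 0 [:: pi / 2; 0; pi / 2; 0] \o val)
  (nth 0 [:: p * tau; q * tau; p * tau; q * tau] \o val)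
  (nth 0 [:: pi / 2; pi / 2; 0; 0] \o val).
Proof.
apply/funext => x; apply/rowP => -[[|[|[|[|//]]]] i4];
  by rewrite !mxE /= ?addr0 ?sinDpihalf !mulrA.
Qed.

Lemma differentiable_torus_chart x : differentiable torus_chart x.
Proof. by rewrite torus_chart_trig; exact: differentiable_trig. Qed.

(** Here and below derivatives are taken in the angles s and t, so the coordinate derivatives carry
    one more factor [tau] per order. The second derivative in s is minus the map itself. *)
Definition torus_ds x : 'rV[R]_4 :=
  let s := tau * x 0 0 in let t := tau * x 0 1 in
  vec4 (- A * sin s * cos (p * t)) (B * cos s * cos (q * t))
       (- A * sin s * sin (p * t)) (B * cos s * sin (q * t)).

Definition torus_dt x : 'rV[R]_4 :=
  let s := tau * x 0 0 in let t := tau * x 0 1 in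
  vec4 (- p * A * cos s * sin (p * t)) (- q * B * sin s * sin (q * t))
       (p * A * cos s * cos (p * t)) (q * B * sin s * cos (q * t)).

Definition torus_dtt x : 'rV[R]_4 :=
  let s := tau * x 0 0 in let t := tau * x 0 1 in
  vec4 (- p ^+ 2 * A * cos s * cos (p * t))
       (- q ^+ 2 * B * sin s * cos (q * t))
       (- p ^+ 2 * A * cos s * sin (p * t))
       (- q ^+ 2 * B * sin s * sin (q * t)).

Lemma derive_torus_s x : 'D_(basis_rV 0) torus_chart x = tau *: torus_ds x.
Proof.
rewrite torus_chart_trig derive_trigE eqxx.
apply/rowP => -[[|[|[|[|//]]]] i4]; rewrite !mxE /= ?addr0 ?add0r ?addrA.
all: rewrite ?(sinDpihalf, cosDpihalf) -!(mulrA _ tau); ring.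
Qed.

Lemma derive_torus_t x : 'D_(basis_rV 1) torus_chart x = tau *: torus_dt x.
Proof.
rewrite torus_chart_trig derive_trigE /=.
apply/rowP => -[[|[|[|[|//]]]] i4]; rewrite !mxE /= ?addr0 ?add0r ?addrA.
all: rewrite ?(sinDpihalf, cosDpihalf) -!(mulrA _ tau); ring.
Qed.

Lemma derive_torus_ss x :
  'D_(basis_rV 0) (fun y => 'D_(basis_rV 0) torus_chart y) x =
  - tau ^+ 2 *: torus_chart x.
Proof.
rewrite [in LHS]torus_chart_trig derive_trig eqxx.
rewrite derive_trigE eqxx.
apply/rowP => -[[|[|[|[|//]]]] i4]; rewrite !mxE /= ?addr0 ?add0r ?addrA.
all: rewrite ?(sinDpihalf, cosDpihalf) -!(mulrA _ tau); ring.
Qed.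

Lemma derive_torus_tt x :
  'D_(basis_rV 1) (fun y => 'D_(basis_rV 1) torus_chart y) x =
  tau ^+ 2 *: torus_dtt x.
Proof.
rewrite [in LHS]torus_chart_trig derive_trig /=.
rewrite derive_trigE /=.
apply/rowP => -[[|[|[|[|//]]]] i4]; rewrite !mxE /= ?addr0 ?add0r ?addrA.
all: rewrite ?(sinDpihalf, cosDpihalf) -!(mulrA _ tau); ring.
Qed.
End TorusInChart.

(** Made for the numerator of [torus_G], with [X] and [Y] a squared cosine and sine: a convex
    combination of [P] and [Q] plus a correction between 0 and [S]. *)
Lemma convex_sum_bounds (R : realFieldType) (P Q S X Y : R) :
  1 <= P -> 1 <= Q -> 0 <= S -> Y = 1 - X -> 0 <= X -> 0 <= Y ->
  1 <= P * X + Q * Y + S * X * Y <= P + Q + S.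
Proof.
move=> P1 Q1 S0 YE X0 Y0; have XY0 : 0 <= X * Y by rewrite mulr_ge0.
have XY1 : X * Y <= 1 by rewrite YE; nra.
have : 0 <= (P - 1) * X by rewrite mulr_ge0 ?subr_ge0.
have : 0 <= (Q - 1) * Y by rewrite mulr_ge0 ?subr_ge0.
have : 0 <= S * (X * Y) by rewrite mulr_ge0.
have : 0 <= S * (1 - X * Y) by rewrite mulr_ge0 ?subr_ge0.
have : 0 <= P * Y by rewrite mulr_ge0 //; lra.
have : 0 <= Q * X by rewrite mulr_ge0 //; lra.
by rewrite YE => *; apply/andP; split; lra.
Qed.

(** * First form, Kahler form and mean curvature of the tori *)

Section TorusGeometry.
Context {R : realType}.
Variables (A B N : R).
Hypotheses (N_gt0 : 0 < N) (A2 : A ^+ 2 = (2 * N + 1) / (N + 1))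
  (B2 : B ^+ 2 = (2 * N + 1) / N).
Notation p := (3 * N + 2).
Notation q := (3 * N + 1).
Notation tau := (@pi R *+ 2).
Variable x : 'rV[R]_2.
Notation X := (cos (tau * x 0 0)).
Notation Y := (sin (tau * x 0 0)).
Notation cp := (cos (p * (tau * x 0 1))).
Notation sp := (sin (p * (tau * x 0 1))).
Notation cq := (cos (q * (tau * x 0 1))).
Notation sq := (sin (q * (tau * x 0 1))).
Notation f := (torus_chart A B p q).
Notation fs := (torus_ds A B p q x).
Notation ft := (torus_dt A B p q x).
Notation ftt := (torus_dtt A B p q x).

(** [r] is [rho] along the torus; [h] and [k] are the only products of [w] and [w *m Jmx] with the
    tangent vectors that do not vanish identically. *)
Let r := 1 + A ^+ 2 * X ^+ 2 + B ^+ 2 * Y ^+ 2.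
Let h := (B ^+ 2 - A ^+ 2) * X * Y.
Let k := p * A ^+ 2 * X ^+ 2 + q * B ^+ 2 * Y ^+ 2.

(** Translation in t acts by diagonal unitary matrices, so none of the scalar products below depends
    on t. Where needed, the t-angles are grouped as cos^2 + sin^2. *)
Let dot_ww : dot (f x) (f x) = A ^+ 2 * X ^+ 2 + B ^+ 2 * Y ^+ 2.
Proof.
rewrite dot_vec4; transitivity (A ^+ 2 * X ^+ 2 * (cp ^+ 2 + sp ^+ 2) +
  B ^+ 2 * Y ^+ 2 * (cq ^+ 2 + sq ^+ 2)); first ring.
by rewrite !cos2Dsin2; ring.
Qed.

Let rho_w : rho (f x) = r.
Proof. by rewrite /rho dot_ww /r addrA. Qed.

Let dot_ws : dot (f x) fs = h.
Proof.
rewrite dot_vec4; transitivity (- A ^+ 2 * X * Y * (cp ^+ 2 + sp ^+ 2) +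
  B ^+ 2 * X * Y * (cq ^+ 2 + sq ^+ 2)); first ring.
by rewrite !cos2Dsin2 /h; ring.
Qed.

Let dot_zs : dot (f x *m Jmx) fs = 0.
Proof. by rewrite vec4J dot_vec4; ring. Qed.

Let dot_wt : dot (f x) ft = 0.
Proof. by rewrite dot_vec4; ring. Qed.

Let dot_zt : dot (f x *m Jmx) ft = k.
Proof.
rewrite vec4J dot_vec4.
transitivity (p * A ^+ 2 * X ^+ 2 * (cp ^+ 2 + sp ^+ 2) +
  q * B ^+ 2 * Y ^+ 2 * (cq ^+ 2 + sq ^+ 2)); first ring.
by rewrite !cos2Dsin2 /k; ring.
Qed.

Let dot_ss : dot fs fs = A ^+ 2 * Y ^+ 2 + B ^+ 2 * X ^+ 2.
Proof.
rewrite dot_vec4; transitivity (A ^+ 2 * Y ^+ 2 * (cp ^+ 2 + sp ^+ 2) +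
  B ^+ 2 * X ^+ 2 * (cq ^+ 2 + sq ^+ 2)); first ring.
by rewrite !cos2Dsin2; ring.
Qed.

Let dot_st : dot fs ft = 0.
Proof. by rewrite dot_vec4; ring. Qed.

Let dot_tt : dot ft ft = p ^+ 2 * A ^+ 2 * X ^+ 2 + q ^+ 2 * B ^+ 2 * Y ^+ 2.
Proof.
rewrite dot_vec4.
transitivity (p ^+ 2 * A ^+ 2 * X ^+ 2 * (cp ^+ 2 + sp ^+ 2) +
  q ^+ 2 * B ^+ 2 * Y ^+ 2 * (cq ^+ 2 + sq ^+ 2)); first ring.
by rewrite !cos2Dsin2; ring.
Qed.

Let dot_sJt : dot (fs *m Jmx) ft = (q * B ^+ 2 - p * A ^+ 2) * X * Y.
Proof.
rewrite vec4J dot_vec4.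
transitivity (- p * A ^+ 2 * X * Y * (cp ^+ 2 + sp ^+ 2) +
  q * B ^+ 2 * X * Y * (cq ^+ 2 + sq ^+ 2)); first ring.
by rewrite !cos2Dsin2; ring.
Qed.

Let Y2 : Y ^+ 2 = 1 - X ^+ 2. Proof. exact: sin2cos2. Qed.
Let N_neq0 : N != 0. Proof. by rewrite gt_eqF. Qed.
Let N1_neq0 : N + 1 != 0. Proof. by rewrite gt_eqF // addr_gt0. Qed.

(** This is (r |f_s|^2 - h^2) / r^2 after reduction by X^2 + Y^2 = 1; [torus_G] is (r |f_t|^2 - k^2)
    / r^2, where its term A^2 B^2 X^2 Y^2 has the coefficient (p - q)^2 = 1. Both numerators are
    visibly positive, which yields the bounds. *)
Definition torus_E : R :=
  (A ^+ 2 * Y ^+ 2 + B ^+ 2 * X ^+ 2 + A ^+ 2 * B ^+ 2) / r ^+ 2.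

Definition torus_G : R :=
  (p ^+ 2 * A ^+ 2 * X ^+ 2 + q ^+ 2 * B ^+ 2 * Y ^+ 2
   + A ^+ 2 * B ^+ 2 * X ^+ 2 * Y ^+ 2) / r ^+ 2.

Let A2_ge1 : 1 <= A ^+ 2.
Proof. by have ? := N_gt0; rewrite A2 ler_pdivlMr; lra. Qed.
Let B2_ge1 : 1 <= B ^+ 2.
Proof. by have ? := N_gt0; rewrite B2 ler_pdivlMr; lra. Qed.
Let X2_ge0 : 0 <= X ^+ 2. Proof. exact: sqr_ge0. Qed.
Let Y2_ge0 : 0 <= Y ^+ 2. Proof. exact: sqr_ge0. Qed.

Let r_ge1 : 1 <= r.
Proof.
by rewrite /r -addrA lerDl addr_ge0 // mulr_ge0 // (le_trans ler01).
Qed.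

Let r_le : r <= 1 + A ^+ 2 + B ^+ 2.
Proof.
have X2_le1 : X ^+ 2 <= 1 by rewrite -subr_ge0 -Y2.
have Y2_le1 : Y ^+ 2 <= 1 by rewrite Y2 gerBl.
by rewrite /r !lerD // ler_piMr // (le_trans ler01).
Qed.

Let r_neq0 : r != 0. Proof. by rewrite gt_eqF // (lt_le_trans ltr01). Qed.

Let quotient_bounds (num M : R) : 1 <= num -> num <= M ->
  1 / (1 + A ^+ 2 + B ^+ 2) ^+ 2 <= num / r ^+ 2 <= M.
Proof.
move=> num1 numM; have r0 := lt_le_trans ltr01 r_ge1.
have r21 : 1 <= r ^+ 2 by rewrite exprn_ege1.
apply/andP; split; last first.
  by rewrite ler_pdivrMr ?exprn_gt0 // (le_trans numM) // ler_peMr //; lra.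
have ? := r_le.
rewrite ler_pM ?invr_ge0 ?sqr_ge0 // lef_pV2 ?posrE ?exprn_gt0 //; last lra.
by rewrite lerXn2r ?nnegrE //; lra.
Qed.

Lemma torus_E_bounds : 1 / (1 + A ^+ 2 + B ^+ 2) ^+ 2 <= torus_E <=
  A ^+ 2 + B ^+ 2 + A ^+ 2 * B ^+ 2.
Proof.
have [[[[a1 b1] y2] x0] y0] := (A2_ge1, B2_ge1, Y2, X2_ge0, Y2_ge0).
by apply: quotient_bounds; nra.
Qed.

Lemma torus_G_bounds : 1 / (1 + A ^+ 2 + B ^+ 2) ^+ 2 <= torus_G <=
  p ^+ 2 * A ^+ 2 + q ^+ 2 * B ^+ 2 + A ^+ 2 * B ^+ 2.
Proof.
have [[[[n0 a1] b1] y2] x0] := (N_gt0, A2_ge1, B2_ge1, Y2, X2_ge0).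
have y0 := Y2_ge0.
have pA : 1 <= p ^+ 2 * A ^+ 2 by nra.
have qB : 1 <= q ^+ 2 * B ^+ 2 by nra.
have AB : 0 <= A ^+ 2 * B ^+ 2 by nra.
have /andP[] := @convex_sum_bounds R _ _ _ _ _ pA qB AB y2 x0 y0.
exact: quotient_bounds.
Qed.

Let bound_gt0 : 0 < 1 / (1 + A ^+ 2 + B ^+ 2) ^+ 2.
Proof.
rewrite divr_gt0 // exprn_gt0 // -addrA ltr_pwDl //.
by rewrite addr_ge0 // sqr_ge0.
Qed.

Let E_gt0 : 0 < torus_E.
Proof. by have /andP[H _] := torus_E_bounds; exact: lt_le_trans H. Qed.

Let G_gt0 : 0 < torus_G.
Proof. by have /andP[H _] := torus_G_bounds; exact: lt_le_trans H. Qed.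

Let row0 : row 0 (jacobian f x) = tau *: fs.
Proof.
by rewrite row_jacobian ?derive_torus_s //; exact: differentiable_torus_chart.
Qed.

Let row1 : row 1 (jacobian f x) = tau *: ft.
Proof.
by rewrite row_jacobian ?derive_torus_t //; exact: differentiable_torus_chart.
Qed.

Definition torus_diag : 'rV[R]_2 :=
  \row_i (tau ^+ 2 * (if i == 0 then torus_E else torus_G)).

Lemma forall_I2 (P : 'I_2 -> Prop) : P 0 -> P 1 -> forall i, P i.
Proof.
move=> P0 P1 [[|[|//]] i2].
- by rewrite (_ : Ordinal i2 = 0) //; exact/val_inj.
- by rewrite (_ : Ordinal i2 = 1) //; exact/val_inj.
Qed.

Let metricZ (M : 'M[R]_4) (u v : 'rV[R]_4) :
  ((tau *: u) *m M *m (tau *: v)^T) 0 0 = tau ^+ 2 * (u *m M *m v^T) 0 0.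
Proof.
by rewrite linearZ /= -!scalemxAl -scalemxAr scalerA mxE expr2.
Qed.

Lemma first_form_torus : first_form fs_metric f x = diag_mx torus_diag.
Proof.
apply/matrixP; do 2![apply: forall_I2];
  rewrite /first_form mulmx_rows [RHS]mxE [in RHS]mxE /=;
  rewrite ?row0 ?row1 metricZ fs_metric_dot rho_w.
all: rewrite ?(dot_ss, dot_st, dot_tt).
all: rewrite ?(dotC fs (f x), dotC ft (f x), dotC ft fs) ?dot_st.
all: rewrite ?(dotC fs (f x *m Jmx), dotC ft (f x *m Jmx)).
all: rewrite ?(dot_ws, dot_zs, dot_wt, dot_zt) ?mulr1n ?mulr0n.
- rewrite /torus_E /h; congr (_ * _).
  apply: (@mulIf _ (r ^+ 2)); first by rewrite expf_neq0.
  rewrite divfK ?expf_neq0 //.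
  transitivity (r * (A ^+ 2 * Y ^+ 2 + B ^+ 2 * X ^+ 2)
     - ((B ^+ 2 - A ^+ 2) * X * Y) ^+ 2); first field=> //.
  by rewrite /r !exprMn Y2; ring.
- ring.
- ring.
- rewrite /torus_G /k; congr (_ * _).
  apply: (@mulIf _ (r ^+ 2)); first by rewrite expf_neq0.
  rewrite divfK ?expf_neq0 //.
  transitivity (r * (p ^+ 2 * A ^+ 2 * X ^+ 2 + q ^+ 2 * B ^+ 2 * Y ^+ 2)
     - k ^+ 2); first by rewrite /k; field=> //.
  by rewrite /r /k Y2; ring.
Qed.

(** The form is alternating, so only the pair of [fs] and [ft] matters. Its value is, up to a power
    of [r], the product of X Y and the constant q B^2 - p A^2 - A^2 B^2, which is zero for the given
    A^2 and B^2. *)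
Lemma kahler_torus :
  jacobian f x *m fs_kahler (f x) *m (jacobian f x)^T = 0.
Proof.
have st0 : ((fs *m Jmx) *m fs_metric (f x) *m ft^T) 0 0 = 0.
  rewrite fs_metric_dot rho_w dot_sJt dotJJ dot_wt dot_zt (dotC fs) dot_ws.
  apply: (@mulIf _ (r ^+ 2)); first by rewrite expf_neq0.
  rewrite mul0r.
  transitivity (r * ((q * B ^+ 2 - p * A ^+ 2) * X * Y) - h * k).
    by field.
  rewrite /r /h /k Y2 A2 B2; field.
  by rewrite N_neq0 N1_neq0.
have ts0 : ((ft *m Jmx) *m fs_metric (f x) *m fs^T) 0 0 = 0.
  apply: oppr_inj; rewrite oppr0 -[RHS]st0 !fs_metric_dot !dotJJ.
  rewrite (dotJl ft) (dotC ft (fs *m _)).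
  rewrite (dotJl ft (f x)) (dotJl fs (f x)).
  rewrite (dotC ft (f x *m _)) (dotC fs (f x *m _)).
  rewrite dot_zs dot_zt dot_wt (dotC ft) dot_wt dot_ws (dotC fs) dot_ws dot_sJt.
  by ring.
have alt (u : 'rV[R]_4) : ((u *m Jmx) *m fs_metric (f x) *m u^T) 0 0 = 0.
  by rewrite fs_metric_dot dotJ dotJl dotJJ !(dotC u); ring.
apply/matrixP => i j; rewrite mulmx_rows fs_kahlerE mulmxA [RHS]mxE.
move: i j; do 2![apply: forall_I2]; 
  rewrite ?row0 ?row1 -[X in X *m fs_metric _]scalemxAl metricZ;
  by rewrite ?(alt, st0, ts0) mulr0.
Qed.

Let cov_ss : cov_deriv fs_metric f x 0 0 =
  tau ^+ 2 *: (- f x - (2 * h / r) *: fs).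
Proof.
rewrite /cov_deriv derive_torus_ss christoffel_fs_sum row0 rho_w.
rewrite !dot_linE dot_ws dot_zs; apply/rowP => c.
by rewrite -!scalemxAl !row_linE; field.
Qed.

Let cov_tt : cov_deriv fs_metric f x 1 1 =
  tau ^+ 2 *: (ftt - (2 * k / r) *: (ft *m Jmx)).
Proof.
rewrite /cov_deriv derive_torus_tt christoffel_fs_sum row1 rho_w.
rewrite !dot_linE dot_wt dot_zt; apply/rowP => c.
by rewrite -!scalemxAl !row_linE; field.
Qed.

Let m1 := (- X + 2 * h * Y / r) / torus_E
          + (- p ^+ 2 * X + 2 * k * p * X / r) / torus_G.
Let m2 := (- Y - 2 * h * X / r) / torus_E
          + (- q ^+ 2 * Y + 2 * k * q * Y / r) / torus_G.

(* [m1] and [m2] are the coefficients of the trace of [cov_deriv] along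
   [A * (cp, sp)] and [B * (cq, sq)]; those of [fs] are [- Y] and [X]. Minimality
   is the proportionality of these two pairs, which depends on the values of [A]
   and [B]. *)
Let radial0 : X * m1 + Y * m2 = 0.
Proof.
have E0 : torus_E != 0 by rewrite gt_eqF.
have G0 : torus_G != 0 by rewrite gt_eqF.
apply: (mulIf (mulf_neq0 E0 G0)); apply: (mulIf r_neq0); rewrite !mul0r.
(* The [h] terms drop out, being multiples of the tangential pair (- Y, X). *)
transitivity (- (r * (X ^+ 2 + Y ^+ 2) * torus_G +
  torus_E * (r * (p ^+ 2 * X ^+ 2 + q ^+ 2 * Y ^+ 2) -
    2 * k * (p * X ^+ 2 + q * Y ^+ 2)))).
  by rewrite /m1 /m2; field; rewrite r_neq0 E0 G0.
apply/eqP; rewrite oppr_eq0; apply/eqP.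
apply: (@mulIf _ (r ^+ 2)); first by rewrite expf_neq0.
rewrite mul0r mulrDl (mulrAC torus_E) -[_ * torus_G * _]mulrA.
rewrite /torus_E /torus_G !divfK ?expf_neq0 //.
rewrite /r /k Y2 A2 B2; field.
by rewrite N_neq0 N1_neq0.
Qed.

Lemma mean_curvature_torus : mean_curvature fs_metric f x = 0.
Proof.
have t0 : tau != 0 by rewrite mulrn_eq0 /= gt_eqF ?pi_gt0.
have E0 : torus_E != 0 by rewrite gt_eqF.
have G0 : torus_G != 0 by rewrite gt_eqF.
have XY1 : X ^+ 2 + Y ^+ 2 = 1 by exact: cos2Dsin2.
(* By [radial0] the pair (m1, m2) is orthogonal to the unit vector (X, Y). It is therefore a
   multiple of (- Y, X), with factor the scalar product X m2 - Y m1. *)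
have m1E : m1 = - (X * m2 - Y * m1) * Y.
  transitivity ((X ^+ 2 + Y ^+ 2) * m1); first by rewrite XY1 mul1r.
  transitivity (X * (X * m1 + Y * m2) + Y ^+ 2 * m1 - X * Y * m2); first ring.
  by rewrite radial0; ring.
have m2E : m2 = (X * m2 - Y * m1) * X.
  transitivity ((X ^+ 2 + Y ^+ 2) * m2); first by rewrite XY1 mul1r.
  transitivity (Y * (X * m1 + Y * m2) + X ^+ 2 * m2 - X * Y * m1); first ring.
  by rewrite radial0; ring.
(* The division by [tau] compensates the row [tau *: fs] of the Jacobian; the factors [tau ^+ 2] of
   [cov_deriv] and [torus_diag] cancel. *)
apply: (@mean_curvature_eq0 _ _ _ _ _ _ first_form_torus _
  (((X * m2 - Y * m1) / tau) *: basis_rV 0)).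
  by apply: forall_I2; rewrite mxE /= mulf_neq0 // expf_neq0.
rewrite cov_ss cov_tt -scalemxAl -rowE row0 scalerA divfK //.
rewrite [torus_diag 0 0]mxE [torus_diag 0 1]mxE /=.
have tauV (a : R) : a != 0 -> (tau ^+ 2 * a)^-1 * tau ^+ 2 = a^-1.
  by move=> a0; rewrite invfM mulrAC mulVf ?mul1r // expf_neq0.
rewrite !scalerA !tauV //.
have comp c :
  (torus_E^-1 *: (- f x - (2 * h / r) *: fs) +
   torus_G^-1 *: (ftt - (2 * k / r) *: (ft *m Jmx))) 0 c =
  torus_E^-1 * (- f x 0 c - 2 * h / r * fs 0 c) +
  torus_G^-1 * (ftt 0 c - 2 * k / r * (ft *m Jmx) 0 c) by rewrite !row_linE.
have KE c : ((X * m2 - Y * m1) *: fs) 0 c = (X * m2 - Y * m1) * fs 0 c.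
  by rewrite row_linE.
apply: vec4P; rewrite comp KE vec4J !mxE /=.
- transitivity (A * cp * m1); first by rewrite /m1; field; rewrite r_neq0 E0 G0.
  by rewrite [in LHS]m1E; ring.
- transitivity (B * cq * m2); first by rewrite /m2; field; rewrite r_neq0 E0 G0.
  by rewrite [in LHS]m2E; ring.
- transitivity (A * sp * m1); first by rewrite /m1; field; rewrite r_neq0 E0 G0.
  by rewrite [in LHS]m1E; ring.
- transitivity (B * sq * m2); first by rewrite /m2; field; rewrite r_neq0 E0 G0.
  by rewrite [in LHS]m2E; ring.
Qed.

Lemma row_free_torus : row_free (jacobian f x).
Proof.
apply: (@row_free_jacobian _ _ _ _ _ _ first_form_torus).
have t0 : tau != 0 by rewrite mulrn_eq0 /= gt_eqF ?pi_gt0.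
by apply: forall_I2; rewrite mxE /= mulf_neq0 ?expf_neq0 // gt_eqF.
Qed.
End TorusGeometry.

(** The integral of a nonnegative function is a supremum over simple functions below it, hence
    monotone. It is applied to the speed of a curve, for which the section below only provides
    bounds on the metric [d]. *)
Lemma ge0_le_integral_nomeas (dsp : measure_display) (T : measurableType dsp)
    (R : realType) (mu : {measure set T -> \bar R}) (D : set T)
    (f g : T -> \bar R) :
  (forall t, D t -> (0 <= f t)%E) -> (forall t, D t -> (f t <= g t)%E) ->
  (\int[mu]_(t in D) f t <= \int[mu]_(t in D) g t)%E.
Proof.
move=> f0 fg; rewrite !(integral_mkcond D).
have fg' t : ((f \_ D) t <= (g \_ D) t)%E by exact: lee_restrict.
have f0' t : (0 <= (f \_ D) t)%E by exact: erestrict_ge0.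
rewrite !ge0_integralTE //; last by move=> t; exact: le_trans (fg' t).
apply: le_ereal_sup => _ [h /= hf <-]; exists h => // t.
exact: le_trans (hf t) (fg' t).
Qed.

(** * Completeness *)

Section TorusCompleteness.
Context {R : realType}.
Notation mu := (@lebesgue_measure R).

Lemma diag_quadratic n (d v : 'rV[R]_n) :
  (v *m diag_mx d *m v^T) 0 0 = \sum_i d 0 i * v 0 i ^+ 2.
Proof.
rewrite mxE; apply: eq_bigr => i _.
by rewrite mul_mx_diag !mxE; ring.
Qed.

Variables (d : 'rV[R]_2 -> 'rV[R]_2) (lo hi : R).
Hypothesis lo_gt0 : 0 < lo.
Hypothesis d_bounds : forall x i, lo <= d x 0 i <= hi.
Let g x : 'M[R]_2 := diag_mx (d x).

Let hi_gt0 : 0 < hi.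
Proof.
by have /andP[h1 h2] := d_bounds 0 0; exact: lt_le_trans (le_trans h1 h2).
Qed.

Lemma speed_ge (x v : 'rV[R]_2) i :
  Num.sqrt lo * `|v 0 i| <= Num.sqrt ((v *m g x *m v^T) 0 0).
Proof.
rewrite -sqrtr_sqr -sqrtrM ?(ltW lo_gt0) // ler_wsqrtr //.
rewrite diag_quadratic (bigD1 i) //=.
rewrite -[leLHS]addr0 lerD //.
  by rewrite ler_wpM2r ?sqr_ge0 //; have /andP[] := d_bounds x i.
apply: sumr_ge0 => j _; rewrite mulr_ge0 ?sqr_ge0 // (le_trans (ltW lo_gt0)) //.
by have /andP[] := d_bounds x j.
Qed.

(** The factor 2 is the number of coordinates. *)
Lemma speed_le (x v : 'rV[R]_2) (e : R) : (forall i, `|v 0 i| <= e) ->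
  Num.sqrt ((v *m g x *m v^T) 0 0) <= Num.sqrt (2 * hi) * e.
Proof.
move=> ve; have e0 : 0 <= e by exact: le_trans (ve 0).
have h0 : 0 <= 2 * hi by rewrite mulr_ge0 // ltW.
rewrite -[in leRHS](ger0_norm e0) -sqrtr_sqr -sqrtrM // ler_wsqrtr //.
rewrite diag_quadratic.
have H i : d x 0 i * v 0 i ^+ 2 <= hi * e ^+ 2.
  rewrite ler_pM ?sqr_ge0 //.
  - by have /andP[h1 _] := d_bounds x i; exact: le_trans (ltW lo_gt0) h1.
  - by have /andP[] := d_bounds x i.
  - by rewrite -real_normK ?num_real // lerXn2r ?nnegrE.
rewrite (le_trans (ler_sum _ (fun i _ => H i))) // sumr_const card_ord.
by rewrite -mulrA mulr_natl.
Qed.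

(** A single curve of small length provides [p] for both coordinates. Each coordinate displacement
    is the integral of a derivative whose absolute value, times [Num.sqrt lo], is at most the
    speed. *)
Lemma torus_dist_lt (x y : 'rV[R]_2) (e : R) :
  (torus_dist g x y < (Num.sqrt lo * e)%:E)%E ->
  exists p : 'rV[int]_2, forall i, `|(y + lattice_vec p - x) 0 i| < e.
Proof.
move=> /ereal_inf_lt[_ [c [cd cc c0 [p c1]] <-] ltc]; exists p => i.
have s0 : 0 < Num.sqrt lo by rewrite sqrtr_gt0.
rewrite -(ltr_pM2l s0) -lte_fin; apply: le_lt_trans ltc.
pose F (t : R) : R := Num.sqrt lo * c t 0 i.
pose f (t : R) : R := Num.sqrt lo * derive1 c t 0 i.
have dF (t : R) : is_derive t (1 : R) F (f t).
  have cdi := (derivable_mxP c t 1).1 (cd t) 0 i.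
  rewrite /f derive1E derive_mx; last exact: cd.
  rewrite mxE.
  have H : is_derive t (1 : R) (fun t => c t 0 i) ('D_1 (fun t => c t 0 i) t).
    exact: derivableP.
  exact: is_deriveZ.
have cf : continuous f.
  move=> t; apply: cvgM; first exact: cvg_cst.
  apply: (@continuous_comp _ _ _ (derive1 c) (fun M : 'rV[R]_2 => M 0 i)).
    exact: cc.
  exact: coord_continuous.
have FTC : (\int[mu]_(t in `[0%R, 1%R]) (f t)%:E = (F 1 - F 0)%:E)%E.
  rewrite EFinB; apply: continuous_FTC2 => //.
  - exact: continuous_subspaceT.
  - split; first by move=> t _; have [] := dF t.
    + apply: cvg_at_right_filter; apply: differentiable_continuous.
      by apply/derivable1_diffP; have [] := dF 0.
    + apply: cvg_at_left_filter; apply: differentiable_continuous.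
      by apply/derivable1_diffP; have [] := dF 1.
  - by move=> t _; rewrite derive1E derive_val.
have -> : Num.sqrt lo * `|(y + lattice_vec p - x) 0 i| = `|F 1 - F 0|.
  by rewrite /F -mulrBr normrM c1 c0 (gtr0_norm s0) !mxE.
rewrite -abse_EFin -FTC; apply: le_trans (le_abse_integral _ _ _) _ => //.
  apply/measurable_EFinP; apply: measurable_funTS.
  exact: continuous_measurable_fun.
apply: ge0_le_integral_nomeas => // t _.
by rewrite abse_EFin lee_fin normrM (gtr0_norm s0) speed_ge.
Qed.

(** The straight segment from [x] to the translate of [y] is a competitor. *)
Lemma torus_dist_le (x y : 'rV[R]_2) (p : 'rV[int]_2) (e : R) :
  (forall i, `|(y + lattice_vec p - x) 0 i| <= e) ->
  (torus_dist g x y <= (Num.sqrt (2 * hi) * e)%:E)%E.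
Proof.
set v := y + _ - x => ve.
pose c (t : R) := x + t *: v.
have dc (t : R) : is_derive t (1 : R) c v.
  have H : (fun h : R => h^-1 *: (c (h *: (1 : R) + t) - c t)) @ 0^' --> v.
    apply: cvg_near_cst; near=> h.
    rewrite /c opprD addrACA subrr add0r -scalerBl addrK scalerA.
    rewrite [h *: 1]mulr1 mulVf ?scale1r //.
    by near: h; exact: nbhs_dnbhs_neq.
  by split; [apply/cvg_ex; exists v | exact/cvg_lim].
have c'E : derive1 c = cst v by apply/funext => t; rewrite derive1E derive_val.
apply: ge_ereal_inf; exists (curve_length g c).
  exists c => //; split.
  - by move=> t; have [] := dc t.
  - by rewrite c'E; exact: cst_continuous.
  - by rewrite /c scale0r addr0.
  - by exists p; rewrite /c scale1r /v addrC subrK.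
rewrite /curve_length.
have -> : (Num.sqrt (2 * hi) * e)%:E =
    (\int[mu]_(t in `[0%R, 1%R]) (Num.sqrt (2 * hi) * e)%:E)%E.
  by rewrite integral_cst //= lebesgue_measure_itv /= lte01 oppr0 adde0 mule1.
apply: ge0_le_integral_nomeas => t _; first by rewrite lee_fin sqrtr_ge0.
by rewrite lee_fin c'E /cst; exact: speed_le.
Unshelve. all: by end_near. Qed.

(** Removing integer parts moves the sequence into the compact unit square, where it has a cluster
    point; a Cauchy sequence converges to any of its cluster points. *)
Lemma torus_complete_diag : torus_complete g.
Proof.
move=> u cau.
have s0 : 0 < Num.sqrt lo by rewrite sqrtr_gt0.
pose fl i : 'rV[int]_2 := \row_k Num.floor (u i 0 k).
pose v i : 'rV[R]_2 := u i - lattice_vec (fl i).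
have [l [_ cl]] :
    ([set w : 'rV[R]_2 | forall k, `[0%R, 1%R]%classic (w ord0 k)] `&`
     cluster (v @ \oo)) !=set0.
  apply: (rV_compact (fun=> @segment_compact R 0 1)).
  exists 0%N => // i _ k /=; rewrite !mxE in_itv /= subr_ge0 floor_le /=.
  by rewrite lerBlDl ltW // -[1]/(1%:~R) -intrD1 // floorD1_gt.
exists l => e e0.
have t0 : 0 < Num.sqrt (2 * hi) by rewrite sqrtr_gt0 mulr_gt0.
(* The Cauchy and the cluster estimates contribute [dl] each; 4 instead of 2 makes the final
   inequality strict. *)
pose dl := e / (Num.sqrt (2 * hi) * 4).
have dl0 : 0 < dl by rewrite divr_gt0 // mulr_gt0.
have [N HN] := cau _ (mulr_gt0 s0 dl0).
exists N => i Ni.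
have [w [[j /= Nj <-] lw]] : ((v @` [set j | (N <= j)%N]) `&` ball l dl) !=set0.
  apply: cl; last exact: nbhsx_ballx.
  by exists N => // j Nj; exists j.
have [p Hp] := torus_dist_lt (HN _ _ Ni Nj).
apply: (@le_lt_trans _ _ (Num.sqrt (2 * hi) * (2 * dl))%:E).
  (* [p] aligns [u j] with [u i], and [fl j] undoes the reduction of [u j] to the unit square. *)
  apply: (@torus_dist_le _ _ (p + fl j)) => k.
  have H1 := Hp k; have H2 : `|l 0 k - v j 0 k| < dl.
    move: lw; rewrite -ball_normE /ball_ /=; apply: le_lt_trans.
    rewrite [leRHS]/Num.Def.normr /= mx_normrE.
    by have := le_bigmax 0 (fun i => `|(l - v j) i.1 i.2|) (0, k); rewrite !mxE.
  have -> : (l + lattice_vec (p + fl j) - u i) 0 k =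
     (u j + lattice_vec p - u i) 0 k + (l 0 k - v j 0 k).
    by rewrite /v !mxE intrD; ring.
  rewrite (le_trans (ler_normD _ _)) // mulr_natl mulr2n lerD // ltW //.
rewrite lte_fin /dl.
have -> : Num.sqrt (2 * hi) * (2 * (e / (Num.sqrt (2 * hi) * 4))) = e / 2.
  by field; rewrite gt_eqF.
by rewrite ltr_pdivrMr // ltr_pMr // ltr1n.
Qed.
End TorusCompleteness.

(** * The tori in the projective plane *)

Section AffinePoints.
Context {R : realType}.
Notation C := R[i].

Definition hvec (a b : C) : 'rV[C]_3 := \row_j nth 0 [:: a; b; 1] j.

Lemma hvec_max a b : hvec a b 0 ord_max = 1.
Proof. by rewrite mxE. Qed.

Lemma hvec_neq0 a b : hvec a b != 0.
Proof.
apply/eqP => /rowP/(_ ord_max); rewrite hvec_max mxE => /eqP.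
by rewrite oner_eq0.
Qed.

Lemma dim_hvec a b : \dim <[hvec a b]> == 1%N.
Proof. by rewrite dim_vline hvec_neq0. Qed.

Definition affine_point (a b : C) : CP2 R :=
  exist _ <[hvec a b]>%VS (dim_hvec a b).

Lemma homog_neq0 (L : CP2 R) : homog L != 0.
Proof.
rewrite /homog vpick0; case: L => L /= /eqP dL.
by apply/eqP => L0; rewrite L0 dimv0 in dL.
Qed.

(** [vpick] returns an unspecified nonzero vector of the line, so homogeneous coordinates are known
    only up to [c]. *)
Lemma homog_affine_point a b :
  exists2 c, c != 0 & homog (affine_point a b) = c *: hvec a b.
Proof.
have /vlineP[c cE] : homog (affine_point a b) \in <[hvec a b]>%VS.
  exact: memv_pick.
exists c => //; apply: contraNneq (homog_neq0 (affine_point a b)) => c0.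
by rewrite cE c0 scale0r.
Qed.

Lemma chart_dom_affine_point a b : chart_dom ord_max (affine_point a b).
Proof.
have [c c0 cE] := homog_affine_point a b.
by rewrite /chart_dom /= cE mxE hvec_max mulr1.
Qed.

Lemma chart_affine_point (a b : C) : chart ord_max (affine_point a b) =
  vec4 (complex.Re a) (complex.Re b) (complex.Im a) (complex.Im b).
Proof.
have [c c0 cE] := homog_affine_point a b.
rewrite vec4_row_mx /chart.
have wE j : homog (affine_point a b) 0 (lift ord_max j) /
    homog (affine_point a b) 0 ord_max = nth 0 [:: a; b] j.
  rewrite cE !mxE /= mulr1 mulrAC divff // mul1r.
  by case: j => [[|[|//]] ?].
congr (@row_mx R 1 2 2 _ _); apply/rowP => j; rewrite !mxE wE;
  by case: j => [[|[|//]] ?].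
Qed.
End AffinePoints.

Section TorusInCP2.
Context {R : realType}.
Notation tau := (@pi R *+ 2).

Lemma cos_sin_addz (u : R) (k : int) :
  (cos (u + tau * k%:~R) = cos u) * (sin (u + tau * k%:~R) = sin u).
Proof.
case: k => k.
  rewrite -pmulrn mulr_natr.
  by rewrite (periodicn (@cosD2pi R)) (periodicn (@sinD2pi R)).
have {2 4}-> : u = (u + tau * (Negz k)%:~R) + tau *+ k.+1.
  by rewrite NegzE intrN mulrN -pmulrn mulr_natr subrK.
by rewrite (periodicn (@cosD2pi R)) (periodicn (@sinD2pi R)).
Qed.

Variable n : nat.
Notation N := (n.+1%:R : R).
Definition torus_A : R := Num.sqrt ((2 * N + 1) / (N + 1)).
Definition torus_B : R := Num.sqrt ((2 * N + 1) / N).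
Notation A := torus_A.
Notation B := torus_B.
Notation p := (3 * N + 2).
Notation q := (3 * N + 1).

Lemma torus_A2 : A ^+ 2 = (2 * N + 1) / (N + 1).
Proof. by rewrite sqr_sqrtr // divr_ge0. Qed.

Lemma torus_B2 : B ^+ 2 = (2 * N + 1) / N.
Proof. by rewrite sqr_sqrtr // divr_ge0. Qed.

Definition cis (z : R) : R[i] := cos z +i* sin z.

Definition torus (x : 'rV[R]_2) : CP2 R :=
  let s := tau * x 0 0 in let t := tau * x 0 1 in
  affine_point ((A * cos s)%:C * cis (p * t)) ((B * sin s)%:C * cis (q * t)).

Lemma chart_torus : chart ord_max \o torus = torus_chart A B p q.
Proof.
apply/funext => x; rewrite /= chart_affine_point /torus_chart /=.
by congr vec4; ring.
Qed.

Lemma torus_map_torus : torus_map torus.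
Proof.
move=> x k; rewrite /torus !mxE.
have pE (m : nat) : m%:R * (tau * (x 0 1 + (k 0 1)%:~R)) =
    m%:R * (tau * x 0 1) + tau * (m%:Z * k 0 1)%:~R.
  by rewrite intrM -pmulrn; ring.
(* Periodicity in t rests on [p] and [q] being integers. *)
have -> : p = (3 * n.+1 + 2)%:R :> R by rewrite natrD natrM.
have -> : q = (3 * n.+1 + 1)%:R :> R by rewrite natrD natrM.
by rewrite !pE mulrDr /cis !cos_sin_addz.
Qed.

Lemma immersion_torus : immersion torus.
Proof.
split=> x.
  exists ord_max, setT; split=> //; first exact: openT.
    by move=> y _; exact: chart_dom_affine_point.
  by rewrite chart_torus torus_chart_trig; exact: smooth_trig.
exists ord_max; first exact: chart_dom_affine_point.
by rewrite chart_torus; apply: row_free_torus torus_A2 torus_B2 _.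
Qed.

Lemma lagrangian_torus : lagrangian torus.
Proof.
move=> x; exists ord_max; first exact: chart_dom_affine_point.
have -> : chart ord_max (torus x) = torus_chart A B p q x.
  by rewrite -chart_torus.
rewrite chart_torus; exact: kahler_torus torus_A2 torus_B2 _.
Qed.

Lemma minimal_torus : minimal torus.
Proof.
move=> x; exists ord_max; first exact: chart_dom_affine_point.
rewrite chart_torus; exact: mean_curvature_torus torus_A2 torus_B2 _.
Qed.

Lemma complete_torus : complete torus.
Proof.
pose d x := torus_diag A B N x.
exists (fun x => diag_mx (d x)).
  move=> x; exists ord_max; first exact: chart_dom_affine_point.
  rewrite chart_torus; symmetry; exact: first_form_torus torus_A2 torus_B2 _.
pose lo := tau ^+ 2 * (1 / (1 + A ^+ 2 + B ^+ 2) ^+ 2).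
pose hi := tau ^+ 2 * (p ^+ 2 * A ^+ 2 + q ^+ 2 * B ^+ 2 + A ^+ 2 * B ^+ 2).
have tau2 : 0 < tau ^+ 2 by rewrite exprn_gt0 // pmulrn_lgt0 ?pi_gt0.
have [a0 b0] : 0 <= A ^+ 2 /\ 0 <= B ^+ 2 by rewrite !sqr_ge0.
have lo0 : 0 < lo.
  rewrite mulr_gt0 // divr_gt0 // exprn_gt0 // -addrA.
  by rewrite ltr_pwDl // addr_ge0.
apply: (@torus_complete_diag _ d lo hi lo0) => x i.
have /andP[E1 E2] := torus_E_bounds (ltr0Sn R n) torus_A2 torus_B2 x.
have /andP[G1 G2] := torus_G_bounds (ltr0Sn R n) torus_A2 torus_B2 x.
rewrite mxE /lo /hi !ler_pM2l //; case: ifP => _; rewrite ?E1 ?G1 ?G2 //=.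
(* [hi] comes from [torus_G]; it also dominates the bound for [torus_E] because [p] and [q] are at
   least 1. *)
apply: le_trans E2 _.
have N1 : 1 <= N by rewrite ler1n.
have p1 : 1 <= p ^+ 2 by rewrite exprn_ege1 //; lra.
have q1 : 1 <= q ^+ 2 by rewrite exprn_ege1 //; lra.
by rewrite lerD2r lerD // ler_peMl.
Qed.

Lemma complete_minimal_lagrangian_torusP :
  complete_minimal_lagrangian_torus torus.
Proof.
by split; [exact: torus_map_torus | exact: immersion_torus |
  exact: lagrangian_torus | exact: minimal_torus | exact: complete_torus].
Qed.
End TorusInCP2.

(** * The circumradius of the tori *)

Section Overlap.
Context {R : realType}.
Notation C := R[i].

Definition nrm2 (z : C) : R := complex.Re z ^+ 2 + complex.Im z ^+ 2.

Lemma nrm2_ge0 z : 0 <= nrm2 z.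
Proof. by rewrite addr_ge0 ?sqr_ge0. Qed.

Lemma nrm2M y z : nrm2 (y * z) = nrm2 y * nrm2 z.
Proof. by case: y => a b; case: z => c d; rewrite /nrm2 /=; ring. Qed.

Lemma nrm2J (z : C) : nrm2 z^* = nrm2 z.
Proof. by case: z => a b; rewrite /nrm2 /= sqrrN. Qed.

Lemma nrm2_eq0 z : (nrm2 z == 0) = (z == 0).
Proof.
by rewrite paddr_eq0 ?sqr_ge0 // !sqrf_eq0 eq_complex.
Qed.

Lemma Re_norm (z : C) : complex.Re `|z| = Num.sqrt (nrm2 z).
Proof. by rewrite normc_def. Qed.

Lemma herm_self n (u : 'rV[C]_n) :
  complex.Re (herm u u) = \sum_j nrm2 (u 0 j).
Proof.
rewrite /herm (raddf_sum (@complex.Re R : Rcomplex R -> R)).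
by apply: eq_bigr => j _; case: (u 0 j) => a b; rewrite /nrm2 /=; ring.
Qed.

Lemma herm_self3 (u : 'rV[C]_3) : complex.Re (herm u u) =
  nrm2 (u 0 0) + nrm2 (u 0 1) + nrm2 (u 0 2%:R).
Proof.
rewrite herm_self !big_ord_recl big_ord0 addr0 addrA.
by congr (nrm2 (u _ _) + nrm2 (u _ _) + nrm2 (u _ _)); exact/val_inj.
Qed.

Lemma herm_self_ge0 n (u : 'rV[C]_n) : 0 <= complex.Re (herm u u).
Proof. by rewrite herm_self sumr_ge0 // => j _; exact: nrm2_ge0. Qed.

Lemma herm_self_gt0 n (u : 'rV[C]_n) : u != 0 -> 0 < complex.Re (herm u u).
Proof.
move=> u0; rewrite lt_def herm_self_ge0 andbT; apply: contra u0 => /eqP.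
rewrite herm_self => /eqP.
rewrite psumr_eq0 => [/allP H|j _]; last exact: nrm2_ge0.
apply/eqP/rowP => j; have := H j (mem_index_enum j).
by rewrite nrm2_eq0 mxE => /eqP.
Qed.

Lemma hermZr n (c : C) (u v : 'rV[C]_n) : herm u (c *: v) = c^* * herm u v.
Proof.
rewrite /herm mulr_sumr; apply: eq_bigr => j _.
by rewrite mxE rmorphM mulrCA.
Qed.

(* The squared cosine of the Fubini-Study distance. *)
Definition overlap (L M : CP2 R) : R :=
  nrm2 (herm (homog L) (homog M)) /
  (complex.Re (herm (homog L) (homog L)) *
   complex.Re (herm (homog M) (homog M))).

(* Lagrange's identity. *)
Lemma herm_CauchySchwarz (u v : 'rV[C]_3) :
  nrm2 (herm u v) <= complex.Re (herm u u) * complex.Re (herm v v).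
Proof.
rewrite !herm_self /herm !big_ord_recl !big_ord0.
set u0 := u 0 _; set u1 := u 0 _; set u2 := u 0 _.
set v0 := v 0 _; set v1 := v 0 _; set v2 := v 0 _.
rewrite -subr_ge0; set D := (X in 0 <= X).
suff -> : D = nrm2 (u0 * v1 - u1 * v0) + nrm2 (u0 * v2 - u2 * v0) +
    nrm2 (u1 * v2 - u2 * v1).
  by apply: addr_ge0 (nrm2_ge0 _); apply: addr_ge0; exact: nrm2_ge0.
rewrite /D {D}; case: u0 u1 u2 v0 v1 v2 => [? ?] [? ?] [? ?] [? ?] [? ?] [? ?].
by rewrite /nrm2 /=; ring.
Qed.

(** By Cauchy-Schwarz the argument of [acos] lies in [-1, 1], where [cos] recovers it; its square is
    the overlap. *)
Lemma fs_dist_overlap (L M L' M' : CP2 R) :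
  fs_dist L M = fs_dist L' M' -> overlap L M = overlap L' M'.
Proof.
pose k (L M : CP2 R) := complex.Re `|herm (homog L) (homog M)|
  / (hnorm (homog L) * hnorm (homog M)).
have k2 (P Q : CP2 R) : k P Q ^+ 2 = overlap P Q.
  rewrite /k /hnorm exprMn exprVn exprMn Re_norm.
  by rewrite !sqr_sqrtr ?nrm2_ge0 ?herm_self_ge0.
have k01 (P Q : CP2 R) : -1 <= k P Q <= 1.
  have k0 : 0 <= k P Q.
    by rewrite /k /hnorm Re_norm divr_ge0 ?mulr_ge0 ?sqrtr_ge0.
  rewrite (le_trans _ k0) ?oppr_le0 //= -(expr_le1 (n := 2)) // k2.
  rewrite ler_pdivrMr ?mul1r ?herm_CauchySchwarz //.
  by rewrite mulr_gt0 // herm_self_gt0 // homog_neq0.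
rewrite /fs_dist -/(k L M) -/(k L' M') => /(congr1 cos).
by rewrite !acosK ?in_itv /= ?k01 // -!k2 => ->.
Qed.

Lemma overlap_affine_point (L : CP2 R) a b :
  overlap L (affine_point a b) = nrm2 (herm (homog L) (hvec a b)) /
    (complex.Re (herm (homog L) (homog L)) * (nrm2 a + nrm2 b + 1)).
Proof.
have [c c0 cE] := homog_affine_point a b.
have hv : complex.Re (herm (hvec a b) (hvec a b)) = nrm2 a + nrm2 b + 1.
  rewrite herm_self !big_ord_recl big_ord0 !mxE /=.
  by rewrite /nrm2 /= ; ring.
have cc : complex.Re (herm (c *: hvec a b) (c *: hvec a b)) =
    nrm2 c * (nrm2 a + nrm2 b + 1).
  rewrite -hv !herm_self mulr_sumr; apply: eq_bigr => j _.
  by rewrite mxE nrm2M.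
rewrite /overlap cE cc hermZr nrm2M nrm2J.
have S0 := herm_self_gt0 (homog_neq0 L).
have h0 : 0 < nrm2 a + nrm2 b + 1 by rewrite ltr_wpDl // addr_ge0 ?nrm2_ge0.
have n0 : nrm2 c != 0 by rewrite nrm2_eq0.
by field; rewrite n0 !gt_eqF.
Qed.

Lemma angle_exists (u v : R) : u ^+ 2 + v ^+ 2 = 1 ->
  exists z, cos z = u /\ sin z = v.
Proof.
move=> uv; have u1 : -1 <= u <= 1.
  rewrite -ler_norml -(expr_le1 (n := 2)) // real_normK ?num_real //.
  by rewrite -uv lerDl sqr_ge0.
have v2 : v ^+ 2 = 1 - u ^+ 2 by rewrite -uv addrAC subrr add0r.
have [v0|v0] := leP 0 v.
  exists (acos u); rewrite acosK ?in_itv // sin_acos // -v2 sqrtr_sqr.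
  by rewrite ger0_norm.
exists (- acos u); rewrite cosN sinN acosK ?in_itv // sin_acos // -v2 sqrtr_sqr.
by rewrite ltr0_norm // opprK.
Qed.

(* The real part of [z * e^(- i t)]. *)
Definition Re_rot (z : C) (t : R) : R :=
  complex.Re z * cos t + complex.Im z * sin t.

Lemma Re_rot_min (z : C) : exists t, Re_rot z t = - Num.sqrt (nrm2 z).
Proof.
have [->|z0] := eqVneq z 0.
  by exists 0; rewrite /Re_rot /nrm2 /= !mul0r expr0n /= addr0 sqrtr0 oppr0.
set r := Num.sqrt _.
have r2 : r ^+ 2 = nrm2 z by rewrite sqr_sqrtr // nrm2_ge0.
have r0 : r != 0 by rewrite -sqrf_eq0 r2 nrm2_eq0.
have [t [ct st]] :
    exists t, cos t = - complex.Re z / r /\ sin t = - complex.Im z / r.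
  apply: angle_exists; rewrite !exprMn !sqrrN -mulrDl exprVn r2 divff //.
  by rewrite nrm2_eq0.
exists t; rewrite /Re_rot ct st.
transitivity (- nrm2 z / r); first by rewrite /nrm2; ring.
by rewrite -r2; field.
Qed.

(** The expansion of |a x e^(- i s) + b y e^(- i t) + c|^2 into three squares and three cross
    terms. *)
Lemma nrm2_herm_hvec (u : 'rV[C]_3) (x y s t : R) :
  let a := u 0 0 in let b := u 0 1 in let c := u 0 2%:R in
  nrm2 (herm u (hvec (x%:C * cis s) (y%:C * cis t))) =
  nrm2 a * x ^+ 2 + nrm2 b * y ^+ 2 + nrm2 c
  + 2 * x * y * Re_rot (a * b^*) (s - t)
  + 2 * x * Re_rot (a * c^*) s + 2 * y * Re_rot (b * c^*) t.
Proof.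
move=> a b c; rewrite /herm !big_ord_recl big_ord0 !mxE /=.
have -> : lift ord0 ord0 = 1 :> 'I_3 by exact/val_inj.
have -> : lift ord0 (lift ord0 ord0) = 2%:R :> 'I_3 by exact/val_inj.
rewrite -/a -/b -/c /Re_rot cosB sinB; have := cos2Dsin2 s; have := cos2Dsin2 t.
case: a b c => [a1 a2] [b1 b2] [c1 c2] /= Et Es.
transitivity ((a1 ^+ 2 + a2 ^+ 2) * x ^+ 2 * (cos s ^+ 2 + sin s ^+ 2) +
  (b1 ^+ 2 + b2 ^+ 2) * y ^+ 2 * (cos t ^+ 2 + sin t ^+ 2) +
  (c1 ^+ 2 + c2 ^+ 2) +
  2 * x * y * ((a1 * b1 + a2 * b2) * (cos s * cos t + sin s * sin t) +
               (a2 * b1 - a1 * b2) * (sin s * cos t - cos s * sin t)) +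
  2 * x * ((a1 * c1 + a2 * c2) * cos s + (a2 * c1 - a1 * c2) * sin s) +
  2 * y * ((b1 * c1 + b2 * c2) * cos t + (b2 * c1 - b1 * c2) * sin t)).
  by rewrite /nrm2 /=; ring.
by rewrite Es Et /nrm2 /=; ring.
Qed.
End Overlap.

(** * The two bounds on the overlap with a torus *)

Section Circumradius.
Context {R : realType}.

(* Here [G] is [sqrt (u * v)]: the left-hand side is [(sqrt u - sqrt v)^2]. *)
Lemma sub_2sqrt_le (u v G M : R) :
  0 <= G -> 0 <= u -> 0 <= v -> G ^+ 2 = u * v -> u <= M -> v <= M ->
  u + v - 2 * G <= M.
Proof.
move=> G0 u0 v0 G2 uM vM; have [uv|/ltW vu] := leP u v.
- suff : u <= G by lra.
  by rewrite -ler_sqr ?nnegrE // G2 expr2 ler_wpM2l.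
- suff : v <= G by lra.
  by rewrite -ler_sqr ?nnegrE // G2 expr2 ler_wpM2r.
Qed.

Lemma sign_exists (k : R) : exists e : R, e ^+ 2 = 1 /\ e * k <= 0.
Proof.
have [k0|/ltW k0] := leP k 0; first by exists 1; rewrite expr1n mul1r.
by exists (-1); rewrite sqrrN expr1n mulN1r oppr_le0.
Qed.

Variable n : nat.
Notation N := (n.+1%:R : R).
Notation tau := (@pi R *+ 2).
Notation A := (torus_A n : R).
Notation B := (torus_B n : R).
Notation p := (3 * N + 2).
Notation q := (3 * N + 1).
Notation F := (@torus R n).

Let N_ge1 : 1 <= N. Proof. by rewrite ler1n. Qed.

Let A_gt0 : 0 < A.
Proof. by have ? := N_ge1; rewrite sqrtr_gt0 divr_gt0 //; lra. Qed.

Let B_gt0 : 0 < B.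
Proof. by have ? := N_ge1; rewrite sqrtr_gt0 divr_gt0 //; lra. Qed.

(** The ellipse passes through the four points with coordinates 1 or -1, where |z1| = |z2| =
    |z3|. *)
Lemma torus_AB : A ^- 2 + B ^- 2 = 1.
Proof.
have N1 := N_ge1; rewrite torus_A2 torus_B2; field.
by do 3?[apply/andP; split]; rewrite gt_eqF //; lra.
Qed.

Lemma add1_torus_A2 : 1 + A ^+ 2 = p / (N + 1).
Proof.
by have N1 := N_ge1; rewrite torus_A2; field; rewrite gt_eqF //; lra.
Qed.

Lemma add1_torus_B2 : 1 + B ^+ 2 = q / N.
Proof.
by have N1 := N_ge1; rewrite torus_B2; field; rewrite gt_eqF //; lra.
Qed.

(** The overlap with the centre is 1 / (1 + |z|^2), and |z|^2 is at most B^2 because A <= B; finally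
    1 + B^2 = q / N. *)
Lemma overlap_torus_ge x : N / q <= overlap (affine_point 0 0) (F x).
Proof.
have N1 := N_ge1.
rewrite /torus overlap_affine_point.
have [c c0 cE] := @homog_affine_point R 0 0.
have -> (u v : R[i]) : herm (homog (affine_point 0 0)) (hvec u v) = c.
  rewrite cE /herm !big_ord_recl big_ord0 !mxE /=.
  rewrite !(mulr0, mul0r, mulr1, add0r, addr0).
  by rewrite [X in c * X](conjc1 R) mulr1.
have -> : complex.Re (herm (homog (affine_point 0 0))
                           (homog (affine_point 0 0))) = nrm2 c :> R.
  rewrite herm_self cE !big_ord_recl big_ord0 !mxE /= !mulr0 mulr1.
  by rewrite /nrm2 /= expr0n /=; ring.
have n0 : nrm2 c != 0 by rewrite nrm2_eq0.
have cis1 z : nrm2 (cis z) = 1 :> R by exact: cos2Dsin2.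
have nrmC (r : R) : nrm2 r%:C = r ^+ 2 by rewrite /nrm2 /= expr0n addr0.
rewrite !nrm2M !cis1 !mulr1 !nrmC invfM mulrA divff // div1r.
set X := cos _; set Y := sin _.
have XY : X ^+ 2 + Y ^+ 2 = 1 by exact: cos2Dsin2.
have AB : A ^+ 2 <= B ^+ 2.
  rewrite torus_A2 torus_B2 ler_pM2l ?lef_pV2 ?posrE //; lra.
have BE := add1_torus_B2; have X0 := sqr_ge0 X; have Y0 := sqr_ge0 Y.
have A0 := sqr_ge0 A.
rewrite -[N / q]invrK invf_div -BE lef_pV2 ?posrE; last 2 first.
- by rewrite ltr_pwDl // sqr_ge0.
- by rewrite ltr_wpDl // addr_ge0 // sqr_ge0.
rewrite !exprMn.
have : A ^+ 2 * X ^+ 2 <= B ^+ 2 * X ^+ 2 by rewrite ler_wpM2r.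
have : B ^+ 2 * X ^+ 2 + B ^+ 2 * Y ^+ 2 = B ^+ 2 by rewrite -mulrDr XY mulr1.
lra.
Qed.

(** The torus is described by a point of the ellipse and the angle t. As p - q = 1, the cross terms
    have the phases t, p t and q t, and any one of them can be prescribed. *)
Lemma overlap_point L (X Y t : R) : X ^+ 2 / A ^+ 2 + Y ^+ 2 / B ^+ 2 = 1 ->
  let u := homog L in
  let a := u 0 0 in let b := u 0 1 in let c := u 0 2%:R in
  exists x, overlap L (F x) =
    (nrm2 a * X ^+ 2 + nrm2 b * Y ^+ 2 + nrm2 c
     + 2 * X * Y * Re_rot (a * b^*) t
     + 2 * X * Re_rot (a * c^*) (p * t) + 2 * Y * Re_rot (b * c^*) (q * t)) /
    ((nrm2 a + nrm2 b + nrm2 c) * (1 + X ^+ 2 + Y ^+ 2)).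
Proof.
move=> XY u a b c.
have [s [Xs Ys]] : exists s, cos s = X / A /\ sin s = Y / B.
  by apply: angle_exists; rewrite !exprMn !exprVn.
have A0 : A != 0 by rewrite gt_eqF.
have B0 : B != 0 by rewrite gt_eqF.
have t0 : tau != 0 by rewrite mulrn_eq0 /= gt_eqF ?pi_gt0.
exists (\row_i ((if i == 0 then s else t) / tau)).
rewrite /torus !mxE /= !(mulrC tau) !divfK // overlap_affine_point.
rewrite nrm2_herm_hvec -/u -/a -/b -/c Xs Ys !(mulrC A) !(mulrC B) !divfK //.
have -> : p * t - q * t = t by ring.
have cis1 z : nrm2 (cis z) = 1 :> R by exact: cos2Dsin2.
have nrmC (r : R) : nrm2 r%:C = r ^+ 2 by rewrite /nrm2 /= expr0n addr0.
rewrite !nrm2M !cis1 !mulr1 !nrmC.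
by rewrite herm_self3; congr (_ / (_ * _)); ring.
Qed.

(* The point of the torus is taken on the circle [z1 = 0], on the circle
   [z2 = 0], or with [|z1| = |z2| = |z3|], according to the relative sizes of
   [al], [be] and [ga]. Rotating it makes two of the three terms of its Hermitian
   product with [L] point in opposite directions, and a change of sign takes care
   of the third. *)
Lemma overlap_torus_le L : exists x, overlap L (F x) <= N / q.
Proof.
have N1 := N_ge1.
have A0 : A != 0 by rewrite gt_eqF.
have B0 : B != 0 by rewrite gt_eqF.
have A20 : A ^+ 2 != 0 by rewrite expf_neq0.
have B20 : B ^+ 2 != 0 by rewrite expf_neq0.
have q0 : 0 < q by lra.
have p0 : 0 < p by lra.
pose a := homog L 0 0; pose b := homog L 0 1; pose c := homog L 0 2%:R.
pose al := nrm2 a; pose be := nrm2 b; pose ga := nrm2 c.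
have P (X Y t : R) : X ^+ 2 / A ^+ 2 + Y ^+ 2 / B ^+ 2 = 1 ->
    exists x, overlap L (F x) =
      (al * X ^+ 2 + be * Y ^+ 2 + ga + 2 * X * Y * Re_rot (a * b^*) t
       + 2 * X * Re_rot (a * c^*) (p * t) + 2 * Y * Re_rot (b * c^*) (q * t)) /
      ((al + be + ga) * (1 + X ^+ 2 + Y ^+ 2)).
  by move=> /overlap_point; exact.
have S0 : 0 < al + be + ga.
  by have := herm_self_gt0 (homog_neq0 L); rewrite herm_self3.
have al0 : 0 <= al := nrm2_ge0 a.
have be0 : 0 <= be := nrm2_ge0 b.
have ga0 : 0 <= ga := nrm2_ge0 c.
have D0 (X Y : R) : 0 < (al + be + ga) * (1 + X ^+ 2 + Y ^+ 2).
  by rewrite mulr_gt0 // -addrA ltr_pwDl // addr_ge0 // sqr_ge0.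
have nJ (y z : R[i]) : nrm2 (y * z^*) = nrm2 y * nrm2 z by rewrite nrm2M nrm2J.
have sq2 (y z : R[i]) : Num.sqrt (nrm2 (y * z^*)) ^+ 2 = nrm2 y * nrm2 z.
  by rewrite sqr_sqrtr ?nrm2_ge0 // nJ.
(* The threshold says be B^2 <= al + be + ga. This is what the circle z1 = 0 needs, since (N / q) (1
   + B^2) = 1. *)
have [Hbe|Hbe] := leP (be * (2 * N + 1)) (N * (al + be + ga)).
  have [t tE] := Re_rot_min (b * c^*).
  have XY : 0 ^+ 2 / A ^+ 2 + B ^+ 2 / B ^+ 2 = 1.
    by rewrite expr0n /= mul0r add0r divff.
  have [x xE] := P 0 B (t / q) XY; exists x; rewrite xE.
  rewrite ler_pdivrMr ?D0 // [q * _]mulrC divfK ?gt_eqF // tE.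
  have := @sub_2sqrt_le (be * B ^+ 2) ga (B * Num.sqrt (nrm2 (b * c^*)))
    (al + be + ga).
  rewrite exprMn sq2 mulr_ge0 ?sqrtr_ge0 ?(ltW B_gt0) // mulr_ge0 ?sqr_ge0 //.
  have H1 : be * B ^+ 2 <= al + be + ga.
    by rewrite torus_B2 mulrA ler_pdivrMr ?ltr0Sn // [leRHS]mulrC.
  have -> : N / q * ((al + be + ga) * (1 + 0 ^+ 2 + B ^+ 2)) = al + be + ga.
    rewrite expr0n /= addr0 add1_torus_B2; field.
    by rewrite !gt_eqF //; lra.
  move=> /(_ isT isT ga0 _ H1) H.
  have : be * B ^+ 2 + ga - 2 * (B * Num.sqrt (nrm2 (b * c^*))) <= al + be + ga.
    by apply: H; [rewrite /be /ga; ring | lra].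
  lra.
(* The threshold says (al + ga) A^2 <= (N / q) (al + be + ga) (1 + A^2), which settles the circle z2
   = 0. *)
have [Hag|Hag] := leP ((al + ga) * ((2 * N + 1) * q)) (N * (al + be + ga) * p).
  have [t tE] := Re_rot_min (a * c^*).
  have XY : A ^+ 2 / A ^+ 2 + 0 ^+ 2 / B ^+ 2 = 1.
    by rewrite expr0n /= mul0r addr0 divff.
  have [x xE] := P A 0 (t / p) XY; exists x; rewrite xE.
  rewrite ler_pdivrMr ?D0 // [p * _]mulrC divfK ?gt_eqF // tE.
  have := @sub_2sqrt_le (al * A ^+ 2) ga (A * Num.sqrt (nrm2 (a * c^*)))
    ((al + ga) * A ^+ 2).
  rewrite exprMn sq2 mulr_ge0 ?sqrtr_ge0 ?(ltW A_gt0) // mulr_ge0 ?sqr_ge0 //.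
  have A21 : 1 <= A ^+ 2 by rewrite torus_A2 ler_pdivlMr; lra.
  have H1 : al * A ^+ 2 <= (al + ga) * A ^+ 2.
    by rewrite ler_wpM2r ?sqr_ge0 // lerDl.
  have H2 : ga <= (al + ga) * A ^+ 2 by nra.
  have H3 : (al + ga) * A ^+ 2 <=
      N / q * ((al + be + ga) * (1 + A ^+ 2 + 0 ^+ 2)).
    rewrite expr0n /= addr0 add1_torus_A2 torus_A2.
    have -> : N / q * ((al + be + ga) * (p / (N + 1))) =
      N * (al + be + ga) * p / q / (N + 1) by ring.
    rewrite mulrA ler_pM2r ?invr_gt0; last lra.
    by rewrite ler_pdivlMr // -(mulrA (al + ga)).
  move=> /(_ isT isT ga0 _ H1 H2) H.
  have : al * A ^+ 2 + ga - 2 * (A * Num.sqrt (nrm2 (a * c^*))) <=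
      (al + ga) * A ^+ 2.
    by apply: H; rewrite /al /ga; ring.
  lra.
(* The two failed thresholds exceed a third of the total for N >= 1. The larger of [al] and [ga] is
   then at least a sixth, and its product with [be] at least 1/18 of the squared total. *)
have be3 : (al + be + ga) / 3 <= be by nra.
have ag3 : (al + be + ga) / 3 <= al + ga by nra.
have key (G : R) : 0 <= G -> (al + be + ga) ^+ 2 / 18 <= G ^+ 2 ->
    (al + be + ga) - 2 * G <= N / q * ((al + be + ga) * (1 + 1 + 1)).
  move=> G0 HG.
  (* An eighth is enough: 1 - 2/8 = 3/4 <= 3 N / q, with equality at N = 1. *)
  have : (al + be + ga) / 8 <= G by rewrite -ler_sqr ?nnegrE //; nra.
  move=> H8; rewrite mulrAC ler_pdivlMr //; nra.
have XY (X Y : R) : X ^+ 2 = 1 -> Y ^+ 2 = 1 ->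
    X ^+ 2 / A ^+ 2 + Y ^+ 2 / B ^+ 2 = 1.
  by move=> -> ->; rewrite !div1r torus_AB.
have [alga|gaal] := leP al ga.
  have [t tE] := Re_rot_min (b * c^*).
  have [e [e2 ek]] := sign_exists
    (Re_rot (a * b^*) (t / q) + Re_rot (a * c^*) (p * (t / q))).
  (* The sign sits on z1 alone, so that it leaves the minimized [b], [c] term unchanged. *)
  have [x xE] := P e 1 (t / q) (XY _ _ e2 (expr1n _ _)); exists x; rewrite xE.
  rewrite ler_pdivrMr ?D0 // [q * _]mulrC divfK ?gt_eqF // tE e2 expr1n.
  have := key (Num.sqrt (nrm2 (b * c^*))) (sqrtr_ge0 _).
  rewrite sq2 -/be -/ga => H.
  have : (al + be + ga) ^+ 2 / 18 <= be * ga.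
    have : (al + be + ga) / 6 <= ga by lra.
    nra.
  move=> /H; lra.
have [t tE] := Re_rot_min (a * b^*).
have [e [e2 ek]] := sign_exists
  (Re_rot (a * c^*) (p * t) + Re_rot (b * c^*) (q * t)).
(* The common sign cancels in the minimized [a], [b] term and controls the other two. *)
have [x xE] := P e e t (XY _ _ e2 e2); exists x; rewrite xE.
rewrite ler_pdivrMr ?D0 // tE -[2 * e * e]mulrA -expr2 e2.
have := key (Num.sqrt (nrm2 (a * b^*))) (sqrtr_ge0 _).
rewrite sq2 -/al -/be => H.
have : (al + be + ga) ^+ 2 / 18 <= al * be.
  have : (al + be + ga) / 6 <= al by lra.
  nra.
move=> /H; lra.
Qed.
End Circumradius.

(** * Pairwise incongruence of the family *)

Theorem theorem1p3 (R : realType) :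
  exists F : nat -> 'rV[R]_2 -> CP2 R,
    (forall n, complete_minimal_lagrangian_torus (F n)) /\
    (forall m n, m <> n -> ~ congruent (range (F m)) (range (F n))).
Proof.
exists (@torus R); split; first exact: complete_minimal_lagrangian_torusP.
move=> m n mn [phi [[psi phiK psiK] iso im]]; apply: mn.
have iso' L M : overlap (phi L) (phi M) = overlap L M.
  exact: fs_dist_overlap (iso L M).
pose I (k : nat) : R := k.+1%:R / (3 * k.+1%:R + 1).
(* Some point of torus [n] has overlap at most [I n] with the image of the centre. Its preimage on
   torus [m] has the same overlap with the centre itself, which is at least [I m]. *)
have le1 : I m <= I n.
  have [x xle] := overlap_torus_le n (phi (affine_point 0 0)).
  have [_ [y _ <-] yx] : (phi @` range (@torus R m)) (torus n x).
    by rewrite im; exists x.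
  apply: le_trans (overlap_torus_ge m y) _.
  by rewrite -iso' yx.
have le2 : I n <= I m.
  (* The same argument for the inverse, with the isometry property of [phi] applied at [psi] of the
     centre. *)
  have [y yle] := overlap_torus_le m (psi (affine_point 0 0)).
  have [x _ xy] : range (@torus R n) (phi (torus m y)).
    by rewrite -im; exists (torus m y) => //; exists y.
  apply: le_trans (overlap_torus_ge n x) _.
  by rewrite xy -(psiK (affine_point 0 0)) iso'.
have /eqP : I m = I n by apply/eqP; rewrite eq_le le1 le2.
have d0 (k : nat) : 3 * k.+1%:R + 1 != 0 :> R.
  by rewrite gt_eqF // ltr_wpDl // mulr_ge0.
(* After cross-multiplication the quadratic terms cancel, so N / (3 N + 1) determines N. *)
rewrite eqr_div // => /eqP E; apply/eqP.
rewrite -eqSS -(eqr_nat R); apply/eqP; lra.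
Qed.
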